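(* Let $S$ be a second countable locally compact Hausdorff topological semigroup with identity, equipped with a $\sigma$-finite positive quasi-invariant Borel measure $\lambda$ such that the map $(s,t)\in S\times S\mapsto\frac{d(s\lambda)}{d\lambda}(t)\in[0,\infty]$ is Borel. Then $(S,\lambda)$ is Liouville if and only if it is Reiter.
   Context: A topological semigroup is a semigroup with a topology for which multiplication is jointly continuous. For $s\in S$ and a Borel measure $\rho$ on $S$, $s\rho$ is the pushforward of $\rho$ under $t\mapsto st$. $\prec$ denotes absolute continuity; $\lambda$ is quasi-invariant if $s\lambda\prec\lambda$ for all $s\in S$. $\|\cdot\|$ is the total variation norm. $(S,\lambda)$ is Reiter if there is a sequence $(\theta_n)_n$ of Borel probability measures on $S$ with $\theta_n\prec\lambda$ for all $n$ and $\lim_{n\to\infty}\|\theta_n-s\theta_n\|=0$ for all $s\in S$. For a probability measure $\pi\prec\lambda$ on $S$, let $P:L^\infty(S,\lambda)\to L^\infty(S,\lambda)$, $P(f)(s)=\int_Sf(st)\,d\pi(t)$, and $H_\pi(S)=\{f\in L^\infty(S,\lambda):P(f)=f\}$. $(S,\lambda)$ is Liouville if there is a probability measure $\pi$ on $S$ with $\pi\prec\lambda$ such that $H_\pi(S)=\mathbb C\mathbf 1$ (the constants). *)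

(* Defs.v *)
From HB Require Import structures.
From mathcomp Require Export all_boot all_order all_algebra complex.
From mathcomp Require Export all_classical all_reals all_analysis.
From mathcomp Require Export measurable_realfun ess_sup_inf.

Set Implicit Arguments.
Unset Strict Implicit.
Unset Printing Implicit Defensive.

Import Order.TTheory GRing.Theory Num.Theory.
Export numFieldNormedType.Exports.

Local Open Scope classical_set_scope.
Local Open Scope ring_scope.

HB.mixin Record Magma_isTopologicalMagma S & Magma S & Topological S := {
  mulg_continuous : continuous (fun p : S * S => (p.1 * p.2)%g)
}.

#[short(type="topSemigroupType")]
HB.structure Definition TopologicalSemigroup :=
  {S of Semigroup S & Topological S & Magma_isTopologicalMagma S}.

#[short(type="topMonoidType")]
HB.structure Definition TopologicalMonoid :=
  {S of TopologicalSemigroup S & Monoid S}.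

(* An alias of [S] carrying the Borel sigma-algebra: the library's measurable
   types must be pointed, and the identity element is used for that here. *)
Definition borel (S : topMonoidType) : Type := S.

Section borel_instances.
Variable S : topMonoidType.

HB.instance Definition _ := Choice.on (borel S).
HB.instance Definition _ := isPointed.Build (borel S) (1%g : S).
HB.instance Definition _ := Measurable.copy (borel S)
  (@g_sigma_algebraType (borel S) (@open S)).

End borel_instances.

Section left_translation.
Variable S : topMonoidType.

Definition lmul (s : S) : borel S -> borel S := fun t => (s * (t : S))%g.

Lemma continuous_lmul (s : S) : continuous (fun t : S => (s * t)%g).
Proof.
move=> t; apply: (@continuous_comp _ _ _ (fun t : S => (s, t))
  (fun p : S * S => (p.1 * p.2)%g)); last exact: mulg_continuous.
by apply: cvg_pair => //=; exact: cvg_cst.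
Qed.

Lemma measurable_lmul (s : S) : measurable_fun [set: borel S] (lmul s).
Proof.
apply: (@measurability _ _ (borel S) (borel S) _ _ (@open S)) => //.
move=> _ [U oU <-]; rewrite setTI; apply: sub_sigma_algebra.
by apply: open_comp => // t _; exact: continuous_lmul.
Qed.

HB.instance Definition _ (s : S) :=
  isMeasurableFun.Build _ _ (borel S) (borel S) (lmul s) (measurable_lmul s).

End left_translation.

Section total_variation_norm.
Context d (T : measurableType d) (R : realType).
Implicit Types (nu : {charge set T -> \bar R}) (mu : {finite_measure set T -> \bar R}).

(* |nu|(T); the value does not depend on the Hahn decomposition chosen
   (see [Hahn_decomposition_uniq]). *)
Definition tv_norm nu : \bar R :=
  charge_variation (projT2 (cid (projT2 (cid (Hahn_decomposition nu))))) setT.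

Definition measure_diff mu1 mu2 : {charge set T -> \bar R} :=
  cadd (charge_of_finite_measure mu1) (copp (charge_of_finite_measure mu2)).

End total_variation_norm.

Section quasi_invariance.
Variables (R : realType) (S : topMonoidType).
Variable lambda : {measure set (borel S) -> \bar R}.

Definition quasi_invariant : Prop :=
  forall s : S, pushforward lambda (lmul s) `<< lambda.

(* [h] is a version of (s, t) |-> d(s lambda)/d lambda (t) with values in
   [0, +oo]; the value +oo is needed because s lambda need not be
   sigma-finite. *)
Definition translate_density (h : S * S -> \bar R) : Prop :=
  (forall p, 0 <= h p)%E /\
  forall (s : S) (A : set (borel S)), measurable A ->
    pushforward lambda (lmul s) A = (\int[lambda]_(t in A) h (s, t))%E.

(* Borel with respect to the product topology on S * S. *)
Definition borel_fun2 (h : S * S -> \bar R) : Prop :=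
  measurable_fun setT
    (h : @g_sigma_algebraType (borel S * borel S)%type (@open (S * S)%type)
         -> \bar R).

Definition borel_translate_density : Prop :=
  exists2 h : S * S -> \bar R, translate_density h & borel_fun2 h.

End quasi_invariance.

Section reiter.
Variables (R : realType) (S : topMonoidType).
Variable lambda : {measure set (borel S) -> \bar R}.

(* [distribution theta (lmul s)] is by definition the pushforward of [theta]
   under [lmul s]. *)
Definition reiter : Prop :=
  exists theta : nat -> probability (borel S) R,
    (forall n, theta n `<< lambda) /\
    forall s : S,
      tv_norm (measure_diff (theta n) (distribution (theta n) (lmul s)))
        @[n --> \oo] --> 0%E.

End reiter.

Section liouville.
Variables (R : realType) (S : topMonoidType).
Variable lambda : {measure set (borel S) -> \bar R}.

(* Elements of complex L^oo are represented by functions, and equality in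
   L^oo is equality lambda-almost everywhere. *)
Definition Linfty : set (borel S -> R[i]) :=
  [set f : borel S -> R[i] |
    [/\ measurable_fun setT (fun s => complex.Re (f s)),
        measurable_fun setT (fun s => complex.Im (f s)) &
        ('N[lambda]_+oo[(fun s => (Normc.normc (f s))%:E)] < +oo)%E]].

Definition Cintegral (pi : {measure set (borel S) -> \bar R})
    (f : borel S -> R[i]) : R[i] :=
  Complex (\int[pi]_t complex.Re (f t)) (\int[pi]_t complex.Im (f t)).

Definition markov_op (pi : {measure set (borel S) -> \bar R})
    (f : borel S -> R[i]) : borel S -> R[i] :=
  fun s => Cintegral pi (fun t => f (lmul s t)).

Definition harmonic (pi : {measure set (borel S) -> \bar R}) :
    set (borel S -> R[i]) :=
  [set f | Linfty f /\ markov_op pi f = f %[ae lambda]].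

Definition Linfty_constants : set (borel S -> R[i]) :=
  [set f | Linfty f /\ exists c : R[i], f = cst c %[ae lambda]].

Definition liouville : Prop :=
  exists pi : probability (borel S) R,
    pi `<< lambda /\ harmonic pi = Linfty_constants.

End liouville.

(* Main.v *)
From HB Require Import structures.
Require Import Defs.
From mathcomp Require Import ring lra.

(** Write [P f (s) = \int f (s t) dpi (t)] for the Markov operator of a
probability [pi << lambda], and [mu pi] for the convolution of two measures, so
that [\int P f dmu = \int f d(mu pi)].

Liouville implies Reiter.  The Cesaro means [theta_n] of the convolution powers
of [pi] are the candidates.  If [theta_n - s theta_n] does not tend to [0] in
total variation, some [e > 0] and some Borel sets [A_n] satisfy
[|theta_n (A_n) - s theta_n (A_n)| > e] for infinitely many [n].  In terms of the
averaged indicators [g_n = (1/n) \sum_k P^k 1_(A_n)] this reads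
[|\int g_n dpi - \int g_n d(s pi)| > e], and telescoping gives
[|P g_n - g_n| <= 2/n].  A weak-star limit [g] of the [g_n] in [L^oo], taken along
an ultrafilter that contains the bad indices, is harmonic because [P] is a dual
operator ([harmonic_weak_limit]), and it still separates [pi] from [s pi], since
both of them are dominated by [lambda].  A constant does not do that.  The
weak-star limit ([weak_limit]) comes from the Radon-Nikodym theorem, applied to
the set function [A |-> lim_U \int_A g_n]: it is dominated by a finite measure,
hence countably additive.

Reiter implies Liouville.  Here [pi = \sum_k 2^-(k+1) theta_(n_k)] for a sparse
subsequence.  Cut this sum at [m] into a head [Q] of mass [1 - 2^-m] and a tail.
If [f] is harmonic with [|f| <= 1], then [f = P_Q f + P_tail f], where [P_tail f]
is the constant [\int f dtail] up to the errors
[e_k (s) = |\int f (s t) dtheta_(n_k) (t) - \int f dtheta_(n_k)|], [k >= m].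
Choosing [c] with [2^-m c = \int f dtail] one gets
[|f - c| <= P_Q |f - c| + \sum_(k >= m) 2^-(k+1) e_k].  Let [la] be a finite
measure dominating [lambda], and integrate this inequality against the potential
[sigma_m = la + la Q + ... + la Q^N], which almost solves
[sigma_m = la + sigma_m Q] once [N] is large: what remains is
[\int |f - c| dla <= small + \sum_(k >= m) 2^-(k+1) \int e_k dsigma_m].
Since [sigma_m] depends only on [n_0, ..., n_(m-1)], each [n_k] can be chosen
after [sigma_0, ..., sigma_k] so as to make all these integrals at most [2^-k],
uniformly in [f]; that such an index exists is dominated convergence
([small_defect]).  Letting [m] grow shows that [f] is almost everywhere constant
([harmonic_ae_cst]). *)

Set Implicit Arguments.
Unset Strict Implicit.
Unset Printing Implicit Defensive.

Import Order.TTheory GRing.Theory Num.Theory.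

Local Open Scope classical_set_scope.
Local Open Scope ring_scope.

(** * Integrals of bounded functions and convolution of finite measures *)

Section bounded_functions.
Context d (T : measurableType d) (R : realType).
Implicit Types (mu nu : {finite_measure set T -> \bar R}) (f g : T -> R).

(** A uniform bound makes a measurable function integrable for every finite
    measure, so real-valued integrals can be manipulated without further side
    conditions. *)
Definition bounded_by (M : R) f :=
  measurable_fun setT f /\ forall x, `|f x| <= M.

Definition mass mu : R := fine (mu setT).

Lemma massE mu : (mass mu)%:E = mu setT.
Proof. by rewrite /mass fineK// fin_num_measure. Qed.

Lemma mass_ge0 mu : 0 <= mass mu.
Proof. by rewrite /mass fine_ge0. Qed.

Lemma mass_probability (P : probability T R) : mass P = 1.
Proof. by rewrite /mass (_ : _ setT = 1%E)//; exact: probability_setT. Qed.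

Lemma bounded_by_ge0 M f : bounded_by M f -> 0 <= M.
Proof. by move=> [_ /(_ point)]; exact: le_trans. Qed.

Lemma bounded_byW M N f : M <= N -> bounded_by M f -> bounded_by N f.
Proof. by move=> MN [mf fM]; split=> // x; exact: le_trans (fM x) MN. Qed.

Lemma bounded_by_cst c : bounded_by `|c| (cst c : T -> R).
Proof. by split. Qed.

Lemma bounded_byD M N f g : bounded_by M f -> bounded_by N g ->
  bounded_by (M + N) (fun x => f x + g x).
Proof.
move=> [mf fM] [mg gN]; split; first exact: measurable_funD.
by move=> x; rewrite (le_trans (ler_normD _ _))// lerD.
Qed.

Lemma bounded_byB M N f g : bounded_by M f -> bounded_by N g ->
  bounded_by (M + N) (fun x => f x - g x).
Proof.
move=> [mf fM] [mg gN]; split; first exact: measurable_funB.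
by move=> x; rewrite (le_trans (ler_normB _ _))// lerD.
Qed.

Lemma bounded_byM M N f g : bounded_by M f -> bounded_by N g ->
  bounded_by (M * N) (fun x => f x * g x).
Proof.
move=> [mf fM] [mg gN]; split; first exact: measurable_funM.
by move=> x; rewrite normrM ler_pM.
Qed.

Lemma bounded_by_norm M f : bounded_by M f -> bounded_by M (fun x => `|f x|).
Proof.
move=> [mf fM]; split; first exact: measurableT_comp.
by move=> x; rewrite normr_id.
Qed.

Lemma bounded_by_indic (A : set T) : measurable A -> bounded_by 1 (\1_A : T -> R).
Proof.
move=> mA; split; first exact: measurable_indic.
by move=> x; rewrite indicE; case: (x \in A); rewrite ?normr1 ?normr0.
Qed.

Lemma bounded_by_integrable mu M f : bounded_by M f ->
  mu.-integrable setT (EFin \o f).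
Proof.
move=> [mf fM]; apply: measurable_bounded_integrable => //.
  by rewrite ltey_eq fin_num_measure.
by exists M; split; [exact: num_real|move=> x Mx y _; exact: le_trans (fM y) (ltW Mx)].
Qed.

Lemma Rintegral_EFin mu M f : bounded_by M f ->
  (\int[mu]_x f x)%:E = (\int[mu]_x (f x)%:E)%E.
Proof.
by move=> bf; rewrite fineK//; apply: integrable_fin_num => //;
  exact: bounded_by_integrable bf.
Qed.

Lemma Rintegral_cstT mu (c : R) : \int[mu]_x c = c * mass mu.
Proof. by rewrite Rintegral_cst. Qed.

Lemma Rintegral_indicT mu (A : set T) : measurable A ->
  \int[mu]_x (\1_A x : R) = fine (mu A).
Proof. by move=> mA; rewrite /Rintegral integral_indic// setIT. Qed.

Lemma bounded_RintegralD mu M N f g : bounded_by M f -> bounded_by N g ->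
  \int[mu]_x (f x + g x) = \int[mu]_x f x + \int[mu]_x g x.
Proof.
by move=> bf bg; rewrite RintegralD//;
  [exact: bounded_by_integrable bf|exact: bounded_by_integrable bg].
Qed.

Lemma bounded_RintegralB mu M N f g : bounded_by M f -> bounded_by N g ->
  \int[mu]_x (f x - g x) = \int[mu]_x f x - \int[mu]_x g x.
Proof.
by move=> bf bg; rewrite RintegralB//;
  [exact: bounded_by_integrable bf|exact: bounded_by_integrable bg].
Qed.

Lemma bounded_RintegralZl mu M f (r : R) : bounded_by M f ->
  \int[mu]_x (r * f x) = r * \int[mu]_x f x.
Proof. by move=> bf; rewrite RintegralZl//; exact: bounded_by_integrable bf. Qed.

Lemma bounded_le_Rintegral mu M N f g : bounded_by M f -> bounded_by N g ->
  (forall x, f x <= g x) -> \int[mu]_x f x <= \int[mu]_x g x.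
Proof.
by move=> bf bg fg; apply: le_Rintegral => //;
  [exact: bounded_by_integrable bf|exact: bounded_by_integrable bg].
Qed.

Lemma norm_Rintegral_le mu M f : bounded_by M f ->
  `|\int[mu]_x f x| <= M * mass mu.
Proof.
move=> bf; rewrite -Rintegral_cstT.
apply: le_trans (le_normr_Rintegral _ (bounded_by_integrable mu bf)) _ => //.
apply: bounded_le_Rintegral (bounded_by_norm bf) (bounded_by_cst M) _.
by case: bf.
Qed.

Lemma norm_Rintegral_norm mu M f : bounded_by M f ->
  `|\int[mu]_x f x| <= \int[mu]_x `|f x|.
Proof. by move=> bf; apply: le_normr_Rintegral => //; exact: bounded_by_integrable bf. Qed.

Lemma eq_ae_Rintegral mu f g : f = g %[ae mu] ->
  measurable_fun setT f -> measurable_fun setT g ->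
  \int[mu]_x f x = \int[mu]_x g x.
Proof.
move=> fg mf mg; congr fine; apply: ae_eq_integral => //.
- exact/measurable_EFinP.
- exact/measurable_EFinP.
- by apply: filterS fg => x /= h Dx; rewrite h.
Qed.

Lemma eq_measure_Rintegral mu nu f :
  (forall A, measurable A -> mu A = nu A) -> \int[mu]_x f x = \int[nu]_x f x.
Proof. by move=> h; congr fine; apply: eq_measure_integral => A mA _; exact: h. Qed.

End bounded_functions.

Section finite_measure_operations.
Context d (T : measurableType d) (R : realType).
Implicit Types (mu nu : {finite_measure set T -> \bar R}).

(** A copy of [measure_add] that carries the structure of a finite measure. *)
Definition fadd mu nu : set T -> \bar R := measure_add mu nu.

Section inst.
Variables mu nu : {finite_measure set T -> \bar R}.
HB.instance Definition _ := Measure.on (fadd mu nu).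
Let fadd_fin : fin_num_fun (fadd mu nu).
Proof. by move=> A mA; rewrite /fadd measure_addE fin_numD !fin_num_measure. Qed.
HB.instance Definition _ := Measure_isFinite.Build _ _ _ (fadd mu nu) fadd_fin.
End inst.

Lemma faddE mu nu A : fadd mu nu A = (mu A + nu A)%E.
Proof. exact: measure_addE. Qed.

Lemma mass_fadd mu nu : mass (fadd mu nu) = mass mu + mass nu.
Proof. by rewrite /mass/= faddE fineD// fin_num_measure. Qed.

Lemma Rintegral_fadd mu nu M (f : T -> R) : bounded_by M f ->
  \int[fadd mu nu]_x f x = \int[mu]_x f x + \int[nu]_x f x.
Proof.
move=> bf; apply: EFin_inj; rewrite EFinD !(Rintegral_EFin _ bf).
by rewrite integral_measure_add//; exact: bounded_by_integrable bf.
Qed.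

Lemma mass_mscale (r : {nonneg R}) mu : mass (mscale r mu) = r%:num * mass mu.
Proof. by rewrite /mass/= /mscale fineM// fin_num_measure. Qed.

(** Scaling is available for nonnegative integrands; adding the bound of [f]
    to it reduces the bounded case to that one. *)
Lemma Rintegral_mscale (r : {nonneg R}) mu M (f : T -> R) : bounded_by M f ->
  \int[mscale r mu]_x f x = r%:num * \int[mu]_x f x.
Proof.
have pos (g : T -> R) N : bounded_by N g -> (forall x, 0 <= g x) ->
    \int[mscale r mu]_x g x = r%:num * \int[mu]_x g x.
  move=> bg g0; apply: EFin_inj; rewrite EFinM !(Rintegral_EFin _ bg).
  rewrite ge0_integral_mscale//; last by move=> x _; rewrite lee_fin.
  by apply/measurable_EFinP; case: bg.
move=> bf.
have bM : bounded_by `|M| (cst M : T -> R) by exact: bounded_by_cst.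
have bMf := bounded_byD bM bf.
have fM0 x : 0 <= cst M x + f x.
  by case: bf => _ /(_ x); rewrite ler_norml => /andP[? _]; rewrite /=; lra.
have := pos _ _ bMf fM0.
rewrite !(bounded_RintegralD _ bM bf) (pos _ _ bM); first by move=> ?; lra.
by move=> x; exact: bounded_by_ge0 bf.
Qed.

End finite_measure_operations.

Section translation.
Context d (T : measurableType d) (R : realType) (mul : {mfun (T * T)%type >-> T}).
Implicit Types (mu nu : {finite_measure set T -> \bar R}) (f : T -> R).

(** The Markov operator of [nu]; for a point mass it is a right
    translation. *)
Definition average nu f : T -> R := fun s => \int[nu]_t f (mul (s, t)).

Lemma bounded_by_translate M f s : bounded_by M f ->
  bounded_by M (fun t => f (mul (s, t))).
Proof.
move=> [mf fM]; split=> //.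
by apply: measurableT_comp => //; apply: measurableT_comp => //; exact: measurable_pair2.
Qed.

(** Measurability in [s] is Tonelli's theorem, applied to [f + M] because that
    function is nonnegative. *)
Lemma bounded_by_average nu M f : bounded_by M f ->
  bounded_by (M * mass nu) (average nu f).
Proof.
move=> bf; split; last first.
  by move=> s; apply: norm_Rintegral_le; exact: bounded_by_translate.
have mF : measurable_fun setT (fun p => (f (mul p) + M)%:E).
  apply/measurable_EFinP; apply: measurable_funD => //.
  by apply: measurableT_comp => //; case: bf.
have := @measurable_fun_fubini_tonelli_F _ _ _ _ _ nu _ mF.
have F0 p : (0 <= (f (mul p) + M)%:E)%E.
  by rewrite lee_fin; case: bf => _ /(_ (mul p)); rewrite ler_norml => /andP[? _]; lra.
move=> /(_ F0) mG.
rewrite (_ : average nu f =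
  fun s => fine (fubini_F nu (fun p => (f (mul p) + M)%:E) s) - M * mass nu).
  apply: measurable_funB => //; exact: measurableT_comp.
apply/funext => s; rewrite /fubini_F -[fine _]/(\int[nu]_t (f (mul (s, t)) + M)).
by rewrite (bounded_RintegralD _ (bounded_by_translate s bf) (bounded_by_cst _ M))
  Rintegral_cstT addrK.
Qed.

Definition conv mu nu : set T -> \bar R := pushforward (mu \x nu)%E mul.

Section conv_instances.
Variables mu nu : {finite_measure set T -> \bar R}.

Let conv0 : conv mu nu set0 = 0%E.
Proof. by rewrite /conv /pushforward preimage_set0 measure0. Qed.

Let conv_ge0 A : (0 <= conv mu nu A)%E. Proof. exact: measure_ge0. Qed.

Let conv_sigma_additive : semi_sigma_additive (conv mu nu).
Proof. exact: (@measure_semi_sigma_additive _ _ _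
  (pushforward (mu \x nu)%E (mul : _ -> _))). Qed.

HB.instance Definition _ :=
  isMeasure.Build _ _ _ (conv mu nu) conv0 conv_ge0 conv_sigma_additive.

Let conv_fin : fin_num_fun (conv mu nu).
Proof.
apply: lty_fin_num_fun; rewrite /= /conv /pushforward preimage_setT -setXTT.
by rewrite product_measure1E// lte_mul_pinfty// ?fin_num_measure// ltey_eq fin_num_measure.
Qed.

HB.instance Definition _ := Measure_isFinite.Build _ _ _ (conv mu nu) conv_fin.
End conv_instances.

Lemma convE mu nu A :
  conv mu nu A = (\int[mu]_s nu ((fun t => mul (s, t)) @^-1` A))%E.
Proof.
apply: eq_integral => s _ /=; congr (nu _).
by apply/seteqP; split => t; rewrite /xsection/= inE.
Qed.

Lemma mass_conv mu nu : mass (conv mu nu) = mass mu * mass nu.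
Proof.
rewrite /mass/= /conv /pushforward preimage_setT -setXTT product_measure1E//.
by rewrite fineM// fin_num_measure.
Qed.

(** Duality between convolution and averaging, by Fubini's theorem: this is
    what makes [average mul nu] the dual of the operator [mu |-> conv mul mu
    nu] on measures. *)
Lemma Rintegral_conv mu nu M f : bounded_by M f ->
  \int[conv mu nu]_x f x = \int[mu]_s average nu f s.
Proof.
move=> bf; apply: EFin_inj.
rewrite !(Rintegral_EFin _ bf) (Rintegral_EFin _ (bounded_by_average nu bf)).
have mF : measurable_fun setT (fun p => f (mul p)).
  by apply: measurableT_comp => //; case: bf.
have iF : (mu \x nu)%E.-integrable setT (EFin \o f \o mul).
  apply/integrable12ltyP; first exact/measurable_EFinP.
  under eq_integral do rewrite -(Rintegral_EFin _
    (bounded_by_norm (bounded_by_translate _ bf))).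
  rewrite -(Rintegral_EFin _ (bounded_by_average nu (bounded_by_norm bf))).
  exact: ltry.
rewrite integral_pushforward//; last by apply/measurable_EFinP; case: bf.
rewrite preimage_setT -integral12_prod_meas1//.
by apply: eq_integral => s _; rewrite (Rintegral_EFin _ (bounded_by_translate s bf)).
Qed.

End translation.

(** * Total variation and asymptotic invariance *)

Section total_variation.
Context d (T : measurableType d) (R : realType).
Implicit Types (mu nu : {finite_measure set T -> \bar R}) (f : T -> R).

Lemma tv_norm_fin_num mu nu : tv_norm (measure_diff mu nu) \is a fin_num.
Proof. by rewrite /tv_norm fin_num_measure. Qed.

Lemma measure_diffE mu nu A : measure_diff mu nu A = (mu A - nu A)%E.
Proof. by []. Qed.

(** With [p - n] the Jordan decomposition of [mu - nu], the measures [mu + n]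
    and [nu + p] coincide, so the two integrals differ by [\int f dp - \int f
    dn]. *)
Lemma le_tv_norm_Rintegral mu nu M f : bounded_by M f ->
  `|\int[mu]_x f x - \int[nu]_x f x| <= M * fine (tv_norm (measure_diff mu nu)).
Proof.
move=> bf; rewrite /tv_norm.
case: cid => P exN; case: cid => N /= nuPN.
rewrite -[charge_variation _]/(charge_variation (nuPN : hahn_decomposition _ P N)).
move: (nuPN : hahn_decomposition (measure_diff mu nu) P N) => {}nuPN.
have [p pE] : exists p : {finite_measure set T -> \bar R},
  forall A, jordan_pos nuPN A = p A by exists (jordan_pos nuPN).
have [n nE] : exists n : {finite_measure set T -> \bar R},
  forall A, jordan_neg nuPN A = n A by exists (jordan_neg nuPN).
have E : \int[fadd mu n]_x f x = \int[fadd nu p]_x f x.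
  apply: eq_measure_Rintegral => A mA; rewrite /= !faddE.
  have := jordan_decomp nuPN mA.
  have -> : cadd (jordan_pos nuPN) (cscale (-1) (jordan_neg nuPN)) A = (p A - n A)%E.
    by rewrite -pE -nE -mulN1e.
  rewrite measure_diffE.
  have fin (m : {finite_measure set T -> \bar R}) : m A \is a fin_num.
    exact: fin_num_measure.
  rewrite -(fineK (fin mu)) -(fineK (fin nu)) -(fineK (fin p)) -(fineK (fin n)).
  by rewrite -!EFinB -!EFinD => -[h]; congr EFin; lra.
move: E; rewrite !(Rintegral_fadd _ _ bf) => E.
have -> : \int[mu]_x f x - \int[nu]_x f x = \int[p]_x f x - \int[n]_x f x by lra.
rewrite /charge_variation/= pE nE fineD ?fin_num_measure//.
by rewrite mulrDr (le_trans (ler_normB _ _))// lerD// norm_Rintegral_le.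
Qed.

(** It is enough to test the two parts [P] and [N] of a Hahn decomposition,
    each of which contributes at most [e]. *)
Lemma tv_norm_le mu nu e :
  (forall A, measurable A -> `|fine (mu A) - fine (nu A)| <= e) ->
  (tv_norm (measure_diff mu nu) <= (e + e)%:E)%E.
Proof.
move=> h; rewrite /tv_norm.
case: cid => P exN; case: cid => N /= nuPN.
rewrite -[charge_variation _]/(charge_variation (nuPN : hahn_decomposition _ P N)).
move: (nuPN : hahn_decomposition (measure_diff mu nu) P N) => {}nuPN.
have [[mP _] [mN _] _ _] := nuPN.
rewrite /charge_variation/= jordan_posE cjordan_posE jordan_negE cjordan_negE.
rewrite /crestr0 !mem_set// /crestr !setTI !measure_diffE.
have fin (m : {finite_measure set T -> \bar R}) A : measurable A -> m A \is a fin_num.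
  by move=> mA; exact: fin_num_measure.
rewrite -(fineK (fin mu _ mP)) -(fineK (fin nu _ mP)).
rewrite -(fineK (fin mu _ mN)) -(fineK (fin nu _ mN)) -!EFinB.
move: (h _ mP) (h _ mN); rewrite lee_fin !ler_norml /= => /andP[? ?] /andP[? ?]; lra.
Qed.

End total_variation.

Section asymptotic_invariance.
Context d (T : measurableType d) (R : realType) (mul : {mfun (T * T)%type >-> T}).
Implicit Types (mu nu : {finite_measure set T -> \bar R}) (f : T -> R).

(** Convergence [theta_n - s theta_n -> 0] in total variation, tested on the
    unit ball of bounded functions so that no signed measure is involved. *)
Definition asymptotically_invariant (theta : nat -> {finite_measure set T -> \bar R}) :=
  forall s, exists2 a : nat -> R, a n @[n --> \oo] --> 0 &
    forall n f, bounded_by 1 f ->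
      `|average mul (theta n) f s - \int[theta n]_x f x| <= a n.

Definition defect nu f (s : T) : R := `|average mul nu f s - \int[nu]_x f x|.

Lemma bounded_by_defect nu M f : bounded_by M f ->
  bounded_by (M * mass nu + M * mass nu) (defect nu f).
Proof.
move=> bf; apply: bounded_by_norm; apply: bounded_byB.
  exact: bounded_by_average.
split=> // _; exact: norm_Rintegral_le.
Qed.

(** The selection step behind the mixture.  A maximal function [sup_f defect]
    over the unit ball need not be measurable; arguing by contradiction one
    has a single bad [f] for each [n], the resulting defects tend to [0]
    pointwise, and dominated convergence applies. *)
Lemma small_defect theta mu (e : R) : 0 < e ->
  (forall n, mass (theta n) = 1) -> asymptotically_invariant theta ->
  exists n, forall f, bounded_by 1 f -> \int[mu]_s defect (theta n) f s <= e.
Proof.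
move=> e0 theta1 ai; apply: contrapT => /forallNP h.
have {h} /choice[F hF] : forall n, exists f, bounded_by 1 f /\
    e < \int[mu]_s defect (theta n) f s.
  move=> n; have /existsNP[f /not_implyP[bf /negP]] := h n.
  by rewrite -ltNge => ?; exists f.
have bD n : bounded_by 2 (defect (theta n) (F n)).
  have := bounded_by_defect (theta n) (hF n).1.
  by rewrite theta1 !mul1r.
have [|||||_ _ cvg0] := @dominated_convergence _ _ _ mu setT measurableT
  (fun n s => (defect (theta n) (F n) s)%:E) (cst 0%E) (cst 2%:E).
- by move=> n; apply/measurable_EFinP; case: (bD n).
- exact: measurable_cst.
- apply: aeW => s _; have [a a0 ha] := ai s.
  apply/fine_cvgP; split; first exact: nearW.
  apply: (@squeeze_cvgr _ _ _ _ (cst 0) a) => //; last exact: cvg_cst.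
  apply: nearW => n /=; rewrite normr_ge0/=; exact: ha (hF n).1.
- exact: (finite_measure_integrable_cst mu 2).
- by apply: aeW => s n _; rewrite lee_fin; case: (bD n).
move: cvg0; rewrite integral0 => /fine_cvgP[_ /cvgrPdist_lt /(_ _ e0)[n _ /(_ n)]].
move=> /(_ (leqnn _)); rewrite /= sub0r normrN => /(le_lt_trans (ler_norm _)).
by rewrite ltNge => /negP; apply; exact/ltW/(hF n).2.
Qed.

End asymptotic_invariance.

(** * A mixture whose bounded harmonic functions are constant *)

Section potential.
Context d (T : measurableType d) (R : realType) (mul : {mfun (T * T)%type >-> T}).
Local Notation fmeas := {finite_measure set T -> \bar R}.
Variables (la Q : fmeas).

(** The truncated Green measure [la + la Q + ... + la Q^N], by Horner's
    scheme. *)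
Fixpoint potential (N : nat) : fmeas :=
  if N is N'.+1 then fadd la (conv mul (potential N') Q) else la.

Lemma potential_step N M (h : T -> R) : bounded_by M h ->
  `|\int[potential N.+1]_x h x - \int[potential N]_x h x|
    <= M * mass Q ^+ N.+1 * mass la.
Proof.
elim: N M h => [|N IH] M h bh /=.
  rewrite (Rintegral_fadd _ _ bh) addrAC subrr add0r.
  rewrite (le_trans (norm_Rintegral_le _ bh))// mass_conv expr1.
  by rewrite [mass la * _]mulrC mulrA.
have bA := bounded_by_average mul Q bh.
rewrite !(Rintegral_fadd _ _ bh) !(Rintegral_conv mul _ _ bh) opprD addrACA subrr add0r.
by rewrite (le_trans (IH _ _ bA))// [in leRHS]exprS [in leRHS]mulrA lexx.
Qed.

(** The balance equation [sigma = la + sigma Q] of the full potential, up to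
    the last term of the truncated one, which is small because [Q] has mass
    less than one. *)
Lemma Rintegral_average_potential N M (h : T -> R) : bounded_by M h ->
  \int[potential N]_x average mul Q h x <=
  \int[potential N]_x h x - \int[la]_x h x + M * mass Q ^+ N.+1 * mass la.
Proof.
move=> bh; have := potential_step N bh.
rewrite /= (Rintegral_fadd _ _ bh) (Rintegral_conv mul _ _ bh) ler_norml => /andP[_ ?].
lra.
Qed.

End potential.

Section mixture.
Context d (T : measurableType d) (R : realType) (mul : {mfun (T * T)%type >-> T}).
Local Notation fmeas := {finite_measure set T -> \bar R}.
Variables (la : fmeas) (theta : nat -> fmeas).
Hypothesis theta1 : forall n, mass (theta n) = 1.
Variables (pick : fmeas * nat -> nat) (len : nat -> nat).

Definition mixture_weight (k : nat) : {nonneg R} := ((2^-1 : R) ^+ k.+1)%:nng.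

(** Stage [k] carries the measure [Q_k = \sum_(j < k) 2^-(j+1) chosen_j] and
    the sum [sigma_0 + ... + sigma_k] of the potentials met so far.  Keeping
    the whole sum lets one call to [pick] control all the [sigma_m] with [m <=
    k] at once. *)
Fixpoint mixture_stage (k : nat) : fmeas * fmeas :=
  if k is k'.+1 then
    let Q : fmeas :=
      fadd (mixture_stage k').1
        (mscale (mixture_weight k') (theta (pick ((mixture_stage k').2, k')))) in
    (Q, fadd (mixture_stage k').2 (potential mul la Q (len k)) : fmeas)
  else let Q : fmeas := mscale 0%:nng la in (Q, potential mul la Q (len 0)).

Definition chosen k : fmeas := theta (pick ((mixture_stage k).2, k)).

Definition partial_mixture k : fmeas := (mixture_stage k).1.

Definition partial_potential k : fmeas := potential mul la (partial_mixture k) (len k).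

Lemma mass_partial_mixture n : mass (partial_mixture n) = 1 - (2^-1) ^+ n.
Proof.
rewrite /partial_mixture; elim: n => [|n IH] /=.
  by rewrite mass_mscale mul0r expr0 subrr.
by rewrite mass_fadd mass_mscale IH theta1 mulr1 /= exprS; lra.
Qed.

Lemma Rintegral_partial_mixtureS n M (f : T -> R) : bounded_by M f ->
  \int[partial_mixture n.+1]_x f x =
  \int[partial_mixture n]_x f x + (2^-1) ^+ n.+1 * \int[chosen n]_x f x.
Proof. by move=> bf; rewrite (Rintegral_fadd _ _ bf) (Rintegral_mscale _ _ bf). Qed.

(** This is how smallness against the accumulated potentials passes to each of
    them. *)
Lemma partial_potential_le_stage m k M (f : T -> R) : (m <= k)%N -> bounded_by M f ->
  (forall x, 0 <= f x) ->
  \int[partial_potential m]_x f x <= \int[(mixture_stage k).2]_x f x.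
Proof.
move=> mk bf f0; rewrite /partial_potential /partial_mixture.
elim: k mk => [|k IH]; first by rewrite leqn0 => /eqP ->.
rewrite leq_eqVlt => /predU1P[->|/IH {}IH] /=; rewrite (Rintegral_fadd _ _ bf).
  by rewrite lerDr; exact: Rintegral_ge0.
by rewrite (le_trans IH)// lerDl; exact: Rintegral_ge0.
Qed.

Definition mixture_tail n : set T -> \bar R :=
  mseries (fun k => mscale (mixture_weight k) (chosen k) : {measure set T -> \bar R}) n.

HB.instance Definition _ n := Measure.on (mixture_tail n).

Lemma mixture_tailS n A : mixture_tail n A =
  (mscale (mixture_weight n) (chosen n) A + mixture_tail n.+1 A)%E.
Proof. by rewrite /mixture_tail /mseries (nneseries_split n 1)// addn1 big_nat1. Qed.

Lemma partial_mixture_tail n A :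
  (partial_mixture n A + mixture_tail n A)%E = mixture_tail 0 A.
Proof.
rewrite /partial_mixture; elim: n => [|n IH] /=; first by rewrite /mscale mul0e add0e.
by rewrite -IH (mixture_tailS n) faddE -addeA.
Qed.

Lemma mixture_tail0T : mixture_tail 0 setT = 1%E.
Proof.
have := @cvg_geometric_eseries_half R 1 0; rewrite expr0 divr1 => /cvg_lim <-//.
rewrite /mixture_tail /mseries; apply: congr_lim; apply/funext => n.
apply: eq_bigr => k _; rewrite /= /mscale.
rewrite [X in (_ * X)%E](_ : _ = 1%E); last first.
  by rewrite -(theta1 (pick ((mixture_stage k).2, k))) massE.
by rewrite mule1 addn1 natrX div1r -exprVn.
Qed.

Let mixture_tail_fin n : fin_num_fun (mixture_tail n).
Proof.
apply: lty_fin_num_fun; rewrite (@le_lt_trans _ _ 1%E) ?ltry//.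
by rewrite -mixture_tail0T -(partial_mixture_tail n) leeDr.
Qed.

HB.instance Definition _ n :=
  Measure_isFinite.Build _ _ _ (mixture_tail n) (@mixture_tail_fin n).

HB.instance Definition _ :=
  Measure_isProbability.Build _ _ _ (mixture_tail 0) mixture_tail0T.

Definition mixture : probability T R := mixture_tail 0.

Lemma mass_mixture_tail n : mass (mixture_tail n) = (2^-1) ^+ n.
Proof.
have := mass_partial_mixture n.
have : mass (partial_mixture n) + mass (mixture_tail n) = 1.
  by rewrite /mass -fineD ?fin_num_measure//= partial_mixture_tail mixture_tail0T.
lra.
Qed.

(** The tail of the mixture after [n] terms is a measure of mass [2^-n]. *)
Lemma mixture_approx n M (f : T -> R) : bounded_by M f ->
  `|\int[mixture]_x f x - \int[partial_mixture n]_x f x| <= M * (2^-1) ^+ n.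
Proof.
move=> bf.
have -> : \int[mixture]_x f x =
    \int[fadd (partial_mixture n) (mixture_tail n)]_x f x.
  by apply: eq_measure_Rintegral => A mA /=; rewrite faddE partial_mixture_tail.
rewrite (Rintegral_fadd _ _ bf) addrAC subrr add0r -mass_mixture_tail.
exact: norm_Rintegral_le.
Qed.

Lemma mixture_dominated (mu : {measure set T -> \bar R}) :
  (forall n, theta n `<< mu) -> mixture `<< mu.
Proof.
move=> dom; apply/null_content_dominatesP => A mA muA.
rewrite /= /mixture_tail /mseries eseries0// => k _ _.
have /null_content_dominatesP := dom (pick ((mixture_stage k).2, k)).
by move=> /(_ A mA muA) chA; rewrite /= /mscale [X in (_ * X)%E](_ : _ = 0%E) ?mule0.
Qed.

Hypothesis pickP : forall m k f, (m <= k)%N -> bounded_by 1 f ->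
  \int[partial_potential m]_s defect mul (chosen k) f s <= (2^-1) ^+ k.

Variable f : T -> R.
Hypothesis bf : bounded_by 1 f.
Hypothesis harm : forall s, average mul mixture f s = f s.

(** The mean of [f] over the normalized tail of the mixture.  Subtracting this
    constant from [f] cancels the contribution of the tail up to its failure
    to be invariant. *)
Definition tail_mean m : R :=
  (\int[mixture]_x f x - \int[partial_mixture m]_x f x) * 2 ^+ m.

Lemma tail_mean_le1 m : `|tail_mean m| <= 1.
Proof.
have := mixture_approx m bf; rewrite mul1r /tail_mean normrM => h.
rewrite [`|2 ^+ m|]ger0_norm ?exprn_ge0//.
by rewrite -ler_pdivlMr ?exprn_gt0// div1r -exprVn.
Qed.

(** Between [m] and [m + j] the two sides differ by the components chosen at
    these stages. *)
Lemma telescoped_defect m j s :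
  `|(average mul (partial_mixture (m + j)) f s - \int[partial_mixture (m + j)]_x f x) -
    (average mul (partial_mixture m) f s - \int[partial_mixture m]_x f x)| <=
  \sum_(k < j) (2^-1) ^+ (m + k).+1 * defect mul (chosen (m + k)) f s.
Proof.
elim: j => [|j IH]; first by rewrite addn0 subrr normr0 big_ord0.
rewrite big_ord_recr/= addnS (Rintegral_partial_mixtureS _ bf).
rewrite {1}/average (Rintegral_partial_mixtureS _ (bounded_by_translate mul s bf)).
rewrite -!/(average mul _ _ _).
have -> (a b c e x y z : R) : a + z * b - (c + z * e) - (x - y) =
  (a - c - (x - y)) + z * (b - e) by ring.
rewrite (le_trans (ler_normD _ _))// lerD// normrM.
by rewrite ger0_norm// exprn_ge0.
Qed.

(** Split the identity [f = average mixture f] at [m] and at [m + j].  The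
    block before [m] averages [f - tail_mean m]; the block between them is
    nearly invariant; the remainder has mass [2^-(m+j)] and enters twice. *)
Lemma harmonic_pointwise m j s :
  `|f s - tail_mean m| <=
  average mul (partial_mixture m) (fun t => `|f t - tail_mean m|) s +
  (\sum_(k < j) (2^-1) ^+ (m + k).+1 * defect mul (chosen (m + k)) f s +
   2 * (2^-1) ^+ (m + j)).
Proof.
set c := tail_mean m.
have bfs := bounded_by_translate mul s bf.
have bfc : bounded_by (1 + `|c|) (fun t => f t - c).
  by apply: bounded_byB bf _; exact: bounded_by_cst.
have h1 := mixture_approx (m + j) bf.
have h2 := mixture_approx (m + j) bfs.
have h3 := telescoped_defect m j s.
have h4 : `|average mul (partial_mixture m) (fun t => f t - c) s| <=
    average mul (partial_mixture m) (fun t => `|f t - c|) s.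
  exact: norm_Rintegral_norm (bounded_by_translate mul s bfc).
have ccst : bounded_by `|c| (cst c : T -> R) by exact: bounded_by_cst.
have E : average mul (partial_mixture m) (fun t => f t - c) s =
    average mul (partial_mixture m) f s - c * (1 - (2^-1) ^+ m).
  by rewrite /average (bounded_RintegralB _ bfs ccst) Rintegral_cstT mass_partial_mixture.
have cE : c * (2^-1) ^+ m = \int[mixture]_x f x - \int[partial_mixture m]_x f x.
  by rewrite /c /tail_mean -mulrA -exprMn divff// expr1n mulr1.
rewrite mul1r in h1; rewrite mul1r -/(average mul mixture f s) in h2.
rewrite -/(average mul (partial_mixture (m + j)) f s) harm in h2.
move: h1 h2 h3 h4; rewrite !ler_norml => /andP[? ?] /andP[? ?] /andP[? ?] /andP[? ?].
by apply/andP; split; lra.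
Qed.

Lemma half_exp_le1 n : 0 <= (2^-1 : R) ^+ n /\ (2^-1 : R) ^+ n <= 1.
Proof. by rewrite exprn_ge0// exprn_ile1// invf_le1// ler1n. Qed.

(** Integrate [harmonic_pointwise] against the [m]-th potential.  By the
    balance equation the averaging term on the right cancels all of [\int |f -
    c| dsigma_m] except [\int |f - c| dla]. *)
Lemma harmonic_L1_telescoped m j :
  \int[la]_s `|f s - tail_mean m| <=
  2 * (1 - (2^-1) ^+ m) ^+ (len m).+1 * mass la + (2^-1) ^+ m +
  2 * (2^-1) ^+ (m + j) * mass (partial_potential m).
Proof.
set c := tail_mean m.
(* [h] is bounded by [2] because [|f| <= 1] and [|c| <= 1] *)
pose h s : R := `|f s - c|.
pose e k s : R := (2^-1) ^+ (m + k).+1 * defect mul (chosen (m + k)) f s.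
have bh : bounded_by 2 h.
  apply: bounded_by_norm; rewrite -[2]/(1 + 1); apply: bounded_byB => //.
  exact: bounded_byW (tail_mean_le1 m) (bounded_by_cst _ _).
have bD k : bounded_by 2 (defect mul (chosen k) f).
  by have := bounded_by_defect mul (chosen k) bf; rewrite theta1 mul1r.
have be k : bounded_by 2 (e k).
  have [mD D2] := bD (m + k)%N; have [w0 w1] := half_exp_le1 (m + k).+1.
  split=> [|s]; first exact: measurable_funM.
  by rewrite /e normrM (ger0_norm w0) -[leRHS]mul1r ler_pM.
(* the [k]-th defect has integral at most [2^-(m+k)] and weight [2^-(m+k+1)],
   so the sum is at most [2^-m] *)
have sumE n : bounded_by (2 *+ n) (fun s => \sum_(k < n) e k s) /\
    \int[partial_potential m]_s (\sum_(k < n) e k s) <= (2^-1) ^+ m * (1 - (2^-1) ^+ n).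
  elim: n => [|n [bn IH]].
    split.
      split=> [|x]; last by rewrite big_ord0 normr0 mulr0n.
      by under eq_fun do rewrite big_ord0; exact: measurable_cst.
    by under eq_Rintegral do rewrite big_ord0; rewrite Rintegral_cstT mul0r expr0 subrr mulr0.
  have E : (fun s => \sum_(k < n.+1) e k s) = (fun s => \sum_(k < n) e k s + e n s).
    by apply/funext => s; rewrite big_ord_recr.
  rewrite E; split; first by rewrite mulrSr; exact: bounded_byD.
  rewrite (bounded_RintegralD _ bn (be n)) (bounded_RintegralZl _ _ (bD (m + n)%N)).
  have [x0 x1] := half_exp_le1 m; have [y0 y1] := half_exp_le1 n.
  have := pickP (leq_addr n m) bf; rewrite !exprS exprD.
  move: ((2^-1) ^+ m) ((2^-1) ^+ n) x0 x1 y0 y1 IH => x y x0 x1 y0 y1 IH hk.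
  have z0 : 0 <= x * y by rewrite mulr_ge0.
  have zz : x * y * (x * y) <= x * y by rewrite ler_piMr// mulr_ile1.
  have := ler_wpM2l z0 hk; lra.
have [bS SE] := sumE j.
have bA := bounded_by_average mul (partial_mixture m) bh.
pose tt : T -> R := cst (2 * (2^-1) ^+ (m + j)).
have bt := bounded_by_cst T (2 * (2^-1) ^+ (m + j) : R); rewrite -/tt in bt.
have := bounded_le_Rintegral (partial_potential m) bh (bounded_byD bA (bounded_byD bS bt))
  (harmonic_pointwise m j).
rewrite (bounded_RintegralD _ bA (bounded_byD bS bt)) (bounded_RintegralD _ bS bt).
rewrite Rintegral_cstT.
have := Rintegral_average_potential mul la (partial_mixture m) (len m) bh.
rewrite -/(partial_potential m) mass_partial_mixture -/h.
have : 0 <= (2^-1 : R) ^+ m * (2^-1) ^+ j by rewrite mulr_ge0 ?exprn_ge0.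
lra.
Qed.

Hypothesis lenP : forall m, (1 - (2^-1) ^+ m) ^+ (len m).+1 * mass la <= (2^-1) ^+ m.

(** The parameter [j] in [harmonic_L1_telescoped] is free: let it tend to
    infinity for fixed [m]. *)
Lemma harmonic_L1 m : \int[la]_s `|f s - tail_mean m| <= 3 * (2^-1) ^+ m.
Proof.
set K := 2 * (2^-1) ^+ m * mass (partial_potential m).
(* [K / 2^j] is the only term of the bound that depends on [j] *)
have cvgp : K * (2^-1) ^+ j @[j --> \oo] --> (0 : R).
  rewrite -(mulr0 K); apply: cvgM; first exact: cvg_cst.
  by apply: cvg_expr; rewrite ger0_norm// invf_lt1// ltr1n.
set x := Rintegral _ _ _; pose q : R := (1 - (2^-1) ^+ m) ^+ (len m).+1.
have : x - (2 * q * mass la + (2^-1) ^+ m) <= 0.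
  apply: (cvgr_to_ge cvgp); apply: nearW => j.
  by have := harmonic_L1_telescoped m j; rewrite -/x -/q exprD /K; lra.
by have := lenP m; rewrite -/q; lra.
Qed.

(** The constants [tail_mean m] may vary with [m], but being close to [f] in
    mean they are all close to the mean of [f], which is therefore the
    constant. *)
Lemma harmonic_ae_cst : exists c, f = cst c %[ae la].
Proof.
(* for [la = 0] every equality holds almost everywhere; otherwise divide by
   the mass *)
have [la0|la_gt0] := eqVneq (mass la) 0.
  exists 0; apply: ae_eq0 => //.
  by apply: (etrans (esym (massE la))); rewrite la0.
have {}la_gt0 : 0 < mass la by rewrite lt_neqAle eq_sym la_gt0 mass_ge0.
pose c := (\int[la]_s f s) / mass la; exists c.
have bfc m : bounded_by (1 + `|tail_mean m|) (fun s => f s - tail_mean m).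
  by apply: bounded_byB bf _; exact: bounded_by_cst.
have b0 : bounded_by (1 + `|c|) (fun s => f s - c).
  by apply: bounded_byB bf _; exact: bounded_by_cst.
have small m : \int[la]_s `|f s - c| <= 6 * (2^-1) ^+ m.
  set cm := tail_mean m.
  have h1 : `|(cm - c) * mass la| <= 3 * (2^-1) ^+ m.
    have -> : (cm - c) * mass la = - \int[la]_s (f s - cm).
      have bcm : bounded_by `|cm| (cst cm : T -> R) by exact: bounded_by_cst.
      rewrite (bounded_RintegralB _ bf bcm) Rintegral_cstT /c mulrBl divfK ?gt_eqF//.
      by rewrite opprB.
    by rewrite normrN (le_trans (norm_Rintegral_norm _ (bfc m)))// harmonic_L1.
  have bd : bounded_by `|cm - c| (cst `|cm - c| : T -> R) by split => // x; rewrite normr_id.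
  apply: (@le_trans _ _ (\int[la]_s (`|f s - cm| + cst `|cm - c| s))).
    apply: bounded_le_Rintegral (bounded_by_norm b0)
      (bounded_byD (bounded_by_norm (bfc m)) bd) _ => s.
    by rewrite /= (le_trans _ (ler_normD _ _))// subrKA.
  rewrite (bounded_RintegralD _ (bounded_by_norm (bfc m)) bd) Rintegral_cstT.
  move: h1; rewrite normrM [`|mass la|]ger0_norm ?mass_ge0//.
  by have := harmonic_L1 m; rewrite -/cm; lra.
have int0 : \int[la]_s `|f s - c| = 0.
  apply/eqP; rewrite eq_le Rintegral_ge0// andbT.
  have cvgp : 6 * (2^-1) ^+ j @[j --> \oo] --> (0 : R).
    rewrite -(mulr0 6); apply: cvgM; first exact: cvg_cst.
    by apply: cvg_expr; rewrite ger0_norm// invf_lt1// ltr1n.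
  by apply: (cvgr_to_ge cvgp); apply: nearW.
have mfc : measurable_fun setT (fun s => (f s - c)%:E).
  by apply/measurable_EFinP; case: b0.
have := (ae_eq_integral_abs la measurableT mfc).1.
rewrite -(Rintegral_EFin la (bounded_by_norm b0)) int0 => /(_ erefl).
by apply: filterS => s /(_ Logic.I) /= [] /eqP; rewrite subr_eq0 => /eqP.
Qed.

End mixture.

(** Both sequences of choices are made here: indices [n_k] against the
    potentials accumulated before, and lengths [N_m] that make [(1 -
    2^-m)^(N_m + 1)] at most [2^-m] relative to the mass of [la]. *)
Theorem asymptotically_invariant_liouville d (T : measurableType d) (R : realType)
    (mul : {mfun (T * T)%type >-> T}) (la : {finite_measure set T -> \bar R})
    (theta : nat -> {finite_measure set T -> \bar R}) :
  (forall n, mass (theta n) = 1) -> asymptotically_invariant mul theta ->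
  exists pi : probability T R,
    (forall mu : {measure set T -> \bar R}, (forall n, theta n `<< mu) -> pi `<< mu) /\
    forall f, bounded_by 1 f -> (forall s, average mul pi f s = f s) ->
      exists c, f = cst c %[ae la].
Proof.
move=> theta1 ai.
have /choice[pick pickP] : forall p : {finite_measure set T -> \bar R} * nat,
    exists n, forall f, bounded_by 1 f ->
      \int[p.1]_s defect mul (theta n) f s <= (2^-1) ^+ p.2.
  by move=> p; apply: small_defect => //; rewrite exprn_gt0.
have /choice[len lenP] : forall m, exists N,
    (1 - (2^-1 : R) ^+ m) ^+ N.+1 * mass la <= (2^-1) ^+ m.
  move=> m; have [x0 x1] := @half_exp_le1 R m.
  have cvg0 : mass la * (1 - (2^-1 : R) ^+ m) ^+ N @[N --> \oo] --> (0 : R).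
    rewrite -(mulr0 (mass la)); apply: cvgM; first exact: cvg_cst.
    by apply: cvg_expr; rewrite ger0_norm ?subr_ge0// ltrBlDr ltrDl exprn_gt0.
  have h0 : 0 < (2^-1 : R) ^+ m by rewrite exprn_gt0.
  move/cvgrPdist_le : cvg0 => /(_ _ h0)[N _ /(_ N.+1 (leqnSn N))].
  by rewrite /= sub0r normrN => /(le_trans (ler_norm _)) hN; exists N; rewrite mulrC.
exists (mixture mul la theta1 pick len); split.
  by move=> mu; exact: mixture_dominated.
move=> f bf harm; apply: (harmonic_ae_cst _ bf harm lenP) => m k g mk bg.
have bD := bounded_by_defect mul (chosen mul la theta pick len k) bg.
have h := partial_potential_le_stage mul la theta pick len mk bD (fun=> normr_ge0 _).
exact: le_trans h (pickP (_, k) g bg).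
Qed.

(** * Weak-star limits of bounded functions along an ultrafilter *)

(** An ultrafilter converges to each of its cluster points, and compactness of
    the segment provides one. *)
Lemma ultra_cvg_bounded (R : realType) (I : Type) (U : set_system I) (a : I -> R) (M : R) :
  UltraFilter U -> (forall n, `|a n| <= M) -> exists l : R, a n @[n --> U] --> l.
Proof.
move=> UU aM; have PU : ProperFilter U by exact: ultra_proper.
have aU : (a @ U) [set` `[- M, M]].
  by apply: (@filterE _ U) => n /=; rewrite in_itv/= -ler_norml aM.
have [l [_ cl]] := segment_compact _ aU.
exists l => V nV; have [//|UV] := @in_ultra_setVsetC _ U (a @^-1` V) UU.
by have [x []] := cl (~` V) V UV nV.
Qed.

Section dominated_additive.
Context d (T : measurableType d) (R : realType).
Variables (la : {finite_measure set T -> \bar R}) (m : set T -> R).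
Hypothesis m_dom : forall A, measurable A -> `|m A| <= fine (la A).
Hypothesis m_add : forall A B, measurable A -> measurable B -> A `&` B = set0 ->
  m (A `|` B) = m A + m B.

Lemma dominated_additive0 : m set0 = 0.
Proof. by have := m_dom measurable0; rewrite measure0 normr_le0 => /eqP. Qed.

(** Domination by a finite measure upgrades finite additivity to countable
    additivity: the remainder of a disjoint series is at most the [la]-measure
    of the uncovered part, which tends to [0]. *)
Lemma dominated_additive_charge :
  exists nu : {charge set T -> \bar R}, forall A, nu A = (m A)%:E.
Proof.
pose nu A := (m A)%:E.
have nu0 : nu set0 = 0%E by rewrite /nu dominated_additive0.
have nufin A : measurable A -> nu A \is a fin_num by [].
have nusig : semi_sigma_additive nu.
  move=> F mF tF mUF.
  (* [G n] is the part covered by the first [n] sets; [m] of its complement in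
     the union is the remainder *)
  pose G n := \big[setU/set0]_(i < n) F i.
  have mG n : measurable (G n) by exact: bigsetU_measurable.
  have mGE n : \sum_(0 <= i < n) m (F i) = m (G n).
    elim: n => [|n IH]; first by rewrite big_geq// /G big_ord0 dominated_additive0.
    rewrite big_nat_recr//= IH /G big_ord_recr/= m_add//; first exact: mG.
    rewrite -bigcup_mkord; apply/seteqP; split=> // x [[i /= lin Fix] Fnx].
    have ein := tF i n Logic.I Logic.I (ex_intro _ x (conj Fix Fnx)).
    by rewrite ein ltnn in lin.
  have GU n : G n `<=` \bigcup_n F n by exact: bigsetU_bigcup.
  have mD n : measurable (\bigcup_n F n `\` G n) by exact: measurableD.
  have laG : fine (la (\bigcup_n F n `\` G n)) @[n --> \oo] --> (0 : R).
    have h n : fine (la (\bigcup_n F n `\` G n)) =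
        fine (la (\bigcup_n F n)) - fine (\sum_(0 <= i < n) la (F i))%E.
      rewrite measureD// ?ltey_eq ?fin_num_measure// (setIidr (GU n)).
      rewrite fineB ?fin_num_measure// big_mkord /G measure_semi_additive_ord_I//.
        by apply: sub_trivIset tF.
      exact: mG.
    under eq_fun do rewrite h.
    rewrite -(subrr (fine (la (\bigcup_n F n)))); apply: cvgB; first exact: cvg_cst.
    apply: fine_cvg; rewrite fineK ?fin_num_measure//.
    exact: measure_semi_sigma_additive.
  rewrite /nu; under eq_fun do rewrite sumEFin mGE.
  apply/fine_cvgP; split; first exact: nearW.
  rewrite /comp/=; apply/subr_cvg0; apply/norm_cvg0P.
  apply: (@squeeze_cvgr _ _ _ _ (cst 0) (fun n => fine (la (\bigcup_n F n `\` G n)))) => //.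
    apply: nearW => n /=; rewrite normr_ge0/= distrC.
    have -> : m (\bigcup_n F n) = m (G n) + m (\bigcup_n F n `\` G n).
      rewrite -m_add//; last by rewrite setDIK.
      by rewrite setDUK.
    by rewrite addrAC subrr add0r; exact: m_dom.
  exact: cvg_cst.
pose nuC : {charge set T -> \bar R} :=
  HB.pack nu (isCharge.Build _ _ _ nu nu0 nufin nusig).
by exists nuC.
Qed.

End dominated_additive.

Section bounded_density.
Context d (T : measurableType d) (R : realType).
Variable la : {finite_measure set T -> \bar R}.

(** Test the hypothesis on the set where [h] is negative. *)
Lemma integral_ge0_ae_ge0 (h : T -> R) : la.-integrable setT (EFin \o h) ->
  (forall A, measurable A -> 0 <= \int[la]_(x in A) h x) ->
  \forall x \ae la, 0 <= h x.
Proof.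
move=> ih hA; have mh : measurable_fun setT h.
  exact/measurable_EFinP/(measurable_int la).
pose N := h @^-1` [set` `]-oo, 0[].
have mN : measurable N by rewrite -[N]setTI; apply: mh.
have iN : la.-integrable N (EFin \o h) by exact: (integrableS measurableT).
have NE x : N x = (h x < 0) :> Prop by rewrite /N /= in_itv.
have : (\int[la]_(x in N) `|(h x)%:E| = 0)%E.
  have -> : (\int[la]_(x in N) `|(h x)%:E| = \int[la]_(x in N) (- (h x)%:E))%E.
    by apply: eq_integral => x /[!inE]; rewrite NE => hx; rewrite lte0_abs ?lte_fin.
  apply/eqP; rewrite eq_le; apply/andP; split; last first.
    by apply: integral_ge0 => x; rewrite NE => hx; rewrite leeNr oppe0 lee_fin ltW.
  rewrite integralN; last exact: integrable_add_def.
  rewrite leeNl oppe0 -[X in (_ <= X)%E]fineK ?lee_fin; first exact: hA.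
  exact: integrable_fin_num.
have mhN : measurable_fun N (EFin \o h) by exact: measurable_int iN.
move=> /(ae_eq_integral_abs la mN mhN).1 [B [mB B0 sub]].
exists B; split => // x /= hx; apply: sub => /= hx0; apply: hx.
have [//|h0] := leP 0 (h x).
have Nx : N x by rewrite NE.
by have [hx00] := hx0 Nx; rewrite hx00 ltxx in h0.
Qed.

(** Domination forces the Radon-Nikodym density into [-1, 1] almost
    everywhere, and truncation makes this bound hold everywhere. *)
Lemma dominated_additive_density (m : set T -> R) :
  (forall A, measurable A -> `|m A| <= fine (la A)) ->
  (forall A B, measurable A -> measurable B -> A `&` B = set0 ->
    m (A `|` B) = m A + m B) ->
  exists2 g, bounded_by 1 g &
    forall A, measurable A -> m A = \int[la]_x (\1_A x * g x).
Proof.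
move=> dom add; have [nu nuE] := dominated_additive_charge dom add.
have nula : nu `<< la.
  apply/null_content_dominatesP => A mA A0; rewrite nuE.
  by have := dom A mA; rewrite A0 normr_le0 => /eqP ->.
pose g0 x := fine (Radon_Nikodym nu la x).
have g0E x : (g0 x)%:E = Radon_Nikodym nu la x.
  by rewrite fineK// Radon_Nikodym_fin_num.
have ig0 : la.-integrable setT (EFin \o g0).
  by apply: eq_integrable (Radon_Nikodym_integrable nula) => // x _; rewrite /= g0E.
have ig0A A : measurable A -> la.-integrable A (EFin \o g0).
  by move=> mA; exact: (integrableS measurableT).
have mg0 : measurable_fun setT g0 by exact/measurable_EFinP/(measurable_int la).
have intg0 A : measurable A -> \int[la]_(x in A) g0 x = m A.
  move=> mA; rewrite /Rintegral; under eq_integral do rewrite g0E.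
  by rewrite -Radon_Nikodym_integral// nuE.
have ic (c : R) A : measurable A -> la.-integrable A (EFin \o cst c).
  by move=> mA; exact: finite_measure_integrable_cst.
have intc (c : R) A : measurable A -> \int[la]_(x in A) cst c x = c * fine (la A).
  by move=> mA; rewrite Rintegral_cst.
have up : \forall x \ae la, 0 <= 1 - g0 x.
  apply: integral_ge0_ae_ge0; first exact: (integrableB measurableT (ic 1 _ _) ig0).
  move=> A mA; rewrite (RintegralB mA (ic 1 A mA) (ig0A A mA)) intc// intg0//.
  by have := dom A mA; rewrite ler_norml => /andP[_ ?]; rewrite mul1r subr_ge0.
have lo : \forall x \ae la, 0 <= 1 + g0 x.
  apply: integral_ge0_ae_ge0; first exact: (integrableD measurableT (ic 1 _ _) ig0).
  move=> A mA; rewrite (RintegralD mA (ic 1 A mA) (ig0A A mA)) intc// intg0//.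
  by have := dom A mA; rewrite ler_norml => /andP[? _]; rewrite mul1r; lra.
pose g x := Num.max (-1) (Num.min 1 (g0 x)).
have mg : measurable_fun setT g.
  by apply: measurable_maxr => //; apply: measurable_minr.
exists g.
  by split=> // x; rewrite ler_norml /g le_max lexx/= ge_max ge_min lexx/= andbT; lra.
move=> A mA; rewrite -intg0// Rintegral_mkcond; apply: eq_ae_Rintegral.
- move: up lo; apply: (@filterS2 _ (almost_everywhere la)) => x h1 h2 _.
  rewrite /g min_r ?max_r//; [|lra..].
  by rewrite /patch indicE; case: ifPn => _ /=; rewrite ?mul1r ?mul0r.
- by apply/(measurable_restrictT _ mA)/measurable_funTS.
- exact: measurable_funM.
Qed.

End bounded_density.

Section weak_limit.
Import HBSimple.
Context d (T : measurableType d) (R : realType).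
Variable la : {finite_measure set T -> \bar R}.
Variables (U : set_system nat) (f : nat -> T -> R).
Hypotheses (UU : UltraFilter U) (bf : forall n, bounded_by 1 (f n)).

Let PU : ProperFilter U. Proof. exact: ultra_proper. Qed.

(** The ultrafilter limits [lim_U \int_A f_n dla] form a finitely additive
    function of [A] dominated by [la]; [g] is its density. *)
Lemma weak_limit_sets : exists2 g, bounded_by 1 g & forall A, measurable A ->
  \int[la]_x (\1_A x * f n x) @[n --> U] --> \int[la]_x (\1_A x * g x).
Proof.
pose b A n : R := \int[la]_x (\1_A x * f n x).
have b1 A n : measurable A -> `|b A n| <= fine (la A).
  move=> mA; rewrite -Rintegral_indicT//.
  have bfA := bounded_byM (bounded_by_indic R mA) (bf n).
  rewrite (le_trans (norm_Rintegral_norm _ bfA))//.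
  apply: bounded_le_Rintegral (bounded_by_norm bfA) (bounded_by_indic R mA) _ => x.
  rewrite normrM ger0_norm// ler_piMr//; by case: (bf n).
have /choice[m mP] : forall A, exists l : R, measurable A -> b A n @[n --> U] --> l.
  move=> A; have [mA|nA] := pselect (measurable A); last by exists 0.
  by have [l bl] := ultra_cvg_bounded UU (fun n => b1 A n mA); exists l.
have dom A : measurable A -> `|m A| <= fine (la A).
  move=> mA; apply: (cvgr_to_le (cvg_norm (mP A mA))).
  by apply: nearW => n; exact: b1.
have add A B : measurable A -> measurable B -> A `&` B = set0 ->
    m (A `|` B) = m A + m B.
  move=> mA mB AB; rewrite -(cvg_lim _ (mP _ (measurableU _ _ mA mB)))//.
  apply/cvg_lim => //.
  have -> : b (A `|` B) = fun n => b A n + b B n.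
    apply/funext => n; rewrite /b -(bounded_RintegralD _
      (bounded_byM (bounded_by_indic R mA) (bf n))
      (bounded_byM (bounded_by_indic R mB) (bf n))).
    apply: eq_Rintegral => x _; rewrite -mulrDl; congr (_ * _).
    rewrite !indicE in_setU.
    have [xA|xA] := boolP (x \in A); have [xB|xB] := boolP (x \in B) => /=;
      rewrite ?addr0 ?add0r//.
    have : (A `&` B) x by split; exact: set_mem.
    by rewrite AB.
  by apply: cvgD; exact: mP.
have [g bg gE] := dominated_additive_density dom add.
by exists g => // A mA; rewrite -gE//; exact: mP.
Qed.

(** Weak-star compactness of the unit ball of [L^oo].  The integrals against
    [mu] are integrals against the density of [mu], an integrable function,
    which is approximated in mean by simple functions; for those the claim is
    [weak_limit_sets] and linearity. *)
Lemma weak_limit : exists2 g, bounded_by 1 g &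
  forall mu : {finite_measure set T -> \bar R}, mu `<< la ->
    \int[mu]_x f n x @[n --> U] --> \int[mu]_x g x.
Proof.
have [g bg gE] := weak_limit_sets; exists g => // mu mula.
pose phi x := fine (Radon_Nikodym (charge_of_finite_measure mu) la x).
have phiE x : (phi x)%:E = Radon_Nikodym (charge_of_finite_measure mu) la x.
  by rewrite fineK// Radon_Nikodym_fin_num.
have iphi : la.-integrable setT (EFin \o phi).
  by rewrite (_ : _ \o _ = Radon_Nikodym (charge_of_finite_measure mu) la);
    [exact: Radon_Nikodym_integrable|exact/funext].
have muE M h : bounded_by M h -> \int[mu]_x h x = \int[la]_x (h x * phi x).
  move=> bh; congr fine; rewrite -(Radon_Nikodym_change_of_variables mula)//.
    by apply: eq_integral => x _; rewrite EFinM phiE.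
  exact: bounded_by_integrable bh.
have simple (psi : {sfun T >-> R}) :
    \int[la]_x (f n x * psi x) @[n --> U] --> \int[la]_x (g x * psi x).
  have [s0 psiE] : exists s : seq R, forall x,
      psi x = \sum_(y <- s) y * \1_(psi @^-1` [set y]) x.
    by eexists => x; rewrite fimfunE fsbig_finite.
  (* generalize the range of [psi] to an arbitrary list so as to argue by
     induction *)
  suff sums (s : seq R) : exists M, bounded_by M
        (fun x => \sum_(y <- s) y * \1_(psi @^-1` [set y]) x) /\
      \int[la]_x (f n x * \sum_(y <- s) y * \1_(psi @^-1` [set y]) x) @[n --> U] -->
      \int[la]_x (g x * \sum_(y <- s) y * \1_(psi @^-1` [set y]) x).
    have [M [_ cvgs]] := sums s0.
    have EQ h : \int[la]_x (h x * psi x) =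
        \int[la]_x (h x * \sum_(y <- s0) y * \1_(psi @^-1` [set y]) x).
      by apply: eq_Rintegral => x _; rewrite psiE.
    by rewrite EQ; under eq_fun do rewrite EQ.
  elim: s => [|y s [M [bs IH]]].
    exists 0; split.
      split=> [|x]; last by rewrite big_nil normr0.
      by under eq_fun do rewrite big_nil; exact: measurable_cst.
    have E0 h : \int[la]_x (h x * \sum_(y <- [::]) y * \1_(psi @^-1` [set y]) x) = 0.
      by under eq_Rintegral do rewrite big_nil mulr0; rewrite Rintegral_cstT mul0r.
    by rewrite E0; under eq_fun do rewrite E0; exact: cvg_cst.
  have mA : measurable (psi @^-1` [set y]) by exact: measurable_funPTI.
  have b1 := bounded_byM (bounded_by_cst T y) (bounded_by_indic R mA).
  exists (`|y| * 1 + M); split.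
    by under eq_fun do rewrite big_cons; exact: bounded_byD.
  have E h : bounded_by 1 h ->
      \int[la]_x (h x * \sum_(y <- (y :: s)) y * \1_(psi @^-1` [set y]) x) =
      y * \int[la]_x (\1_(psi @^-1` [set y]) x * h x) +
      \int[la]_x (h x * \sum_(y <- s) y * \1_(psi @^-1` [set y]) x).
    move=> bh; have b2 := bounded_byM (bounded_by_indic R mA) bh.
    rewrite -(bounded_RintegralZl _ _ b2).
    rewrite -(bounded_RintegralD _ (bounded_byM (bounded_by_cst T y) b2) (bounded_byM bh bs)).
    by apply: eq_Rintegral => x _; rewrite big_cons /=; ring.
  under eq_fun do rewrite (E _ (bf _)).
  rewrite (E _ bg); apply: cvgD => //.
  by apply: cvgMr; exact: gE.
apply/cvgrPdist_lt => e e0; have e4 : 0 < e / 4 by rewrite divr_gt0.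
have [psi_ [ipsi _ /fine_cvgP[fin /cvgrPdist_lt /(_ _ e4)]]] :=
  approximation_sfun_integrable measurableT iphi.
move=> near1; have [k _ /(_ k (leqnn _))/= []] := filterI fin near1.
set psi := psi_ k => fk; rewrite sub0r normrN => small.
have idiff : la.-integrable setT (EFin \o (fun x => phi x - psi x)).
  exact: (integrableB measurableT iphi (ipsi k)).
(* the error of replacing the density [phi] by [psi] is uniform over the unit
   ball, hence uniform in [n] *)
have close h : bounded_by 1 h ->
    `|\int[mu]_x h x - \int[la]_x (h x * psi x)| <= e / 4.
  move=> bh; rewrite (muE _ _ bh).
  have ih (u : T -> R) : la.-integrable setT (EFin \o u) ->
      la.-integrable setT (EFin \o (fun x => h x * u x)).
    move=> iu; have [mh h1] := bh.
    apply: (integrableMr measurableT mh _ iu).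
    exists 1; split=> [|r r1 x _]; first exact: num_real.
    exact: le_trans (h1 x) (ltW r1).
  rewrite -(RintegralB measurableT (ih _ iphi) (ih _ (ipsi k))).
  under eq_Rintegral do rewrite -mulrBr.
  rewrite (le_trans (le_normr_Rintegral measurableT (ih _ idiff)))//.
  apply: le_trans (ltW small); rewrite (le_trans _ (ler_norm _))//.
  apply: le_Rintegral => //; [exact: integrable_norm (ih _ idiff)|
    exact: integrable_norm idiff|].
  by move=> x _; rewrite normrM ler_piMl//; case: bh.
have := simple psi => /cvgrPdist_lt /(_ _ e4); apply: filterS => n.
have := close _ bg; have := close _ (bf n).
rewrite !ler_norml !ltr_norml => /andP[? ?] /andP[? ?] /andP[? ?].
by apply/andP; split; lra.
Qed.

End weak_limit.

(** * Borel structure of the semigroup *)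

Lemma countable_bigcup_measurable d (T : measurableType d) (I : Type) (D : set I)
    (F : I -> set T) : countable D ->
  (forall i, D i -> measurable (F i)) -> measurable (\bigcup_(i in D) F i).
Proof.
move=> cD mF; rewrite bigcup_set_type; apply: countable_bigcupT_measurable.
  by rewrite (eq_countable (card_setT D)).
by move=> i; apply: mF; exact: set_valP.
Qed.

Section borel_multiplication.
Variable S : topMonoidType.
Hypothesis countable_basis : @second_countable S.

Definition mulp (p : borel S * borel S) : borel S := ((p.1 : S) * (p.2 : S))%g.

(** The Borel sets of the product space belong to the product of the Borel
    sigma-algebras because every open set is a countable union of basic
    rectangles; this is where second countability is used. *)
Lemma open_borel_prod (U : set (S * S)) : open U ->
  measurable (U : set (borel S * borel S)).
Proof.
move=> oU; have [B cB [oB bB]] := countable_basis.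
(* the pairs of basic open sets whose rectangle lies in [U] *)
pose D := [set C : set S * set S | [/\ B C.1, B C.2 & C.1 `*` C.2 `<=` U]].
have -> : U = \bigcup_(C in D) (C.1 `*` C.2).
  apply/seteqP; split=> [[x y] Uxy|[x y] [C [_ _ CU] Cxy]]; last exact: CU.
  have : nbhs (x, y) U by exact: open_nbhs_nbhs.
  move=> [[V W]/= [nV nW] VWU].
  have [X [BX Xx] XV] := bB x _ nV; have [Y [BY Yy] YW] := bB y _ nW.
  exists (X, Y) => //=; split=> //= -[a b] /= [Xa Yb].
  by apply: VWU; split; [exact: XV|exact: YW].
apply: countable_bigcup_measurable.
  by apply: sub_countable (countableX cB cB); apply: subset_card_le => C [].
move=> C [B1 B2 _]; apply: (@measurableX _ _ (borel S) (borel S)).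
  by apply: sub_sigma_algebra; exact: oB.
by apply: sub_sigma_algebra; exact: oB.
Qed.

Lemma measurable_mulp : measurable_fun setT mulp.
Proof.
apply: (@measurability _ _ (borel S * borel S)%type (borel S) _ _ (@open S)) => //.
move=> _ [U oU <-]; rewrite setTI; apply: open_borel_prod.
by apply: open_comp => // p _; exact: mulg_continuous.
Qed.

End borel_multiplication.

Section dominating_finite_measure.
Context d (T : measurableType d) (R : realType).

(** Weight the pieces [F n] of finite measure by [2^-(n+1) / (1 + lambda (F
    n))], so that the total mass stays at most one. *)
Lemma dominating_finite_measure (lambda : {sigma_finite_measure set T -> \bar R}) :
  exists la : {finite_measure set T -> \bar R}, lambda `<< la.
Proof.
have [F TF mF] := sigma_finiteT lambda.
have mFn n : measurable (F n) by case: (mF n).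
pose w n : R := (2 ^+ (0 + n.+1))^-1 / (1 + fine (lambda (F n))).
have F0 n : 0 <= fine (lambda (F n)) by rewrite fine_ge0.
have w0 n : 0 < w n by rewrite divr_gt0// ltr_wpDr.
pose W n : {nonneg R} := NngNum (ltW (w0 n)).
pose m n : {measure set T -> \bar R} := mscale (W n) (mrestr lambda (mFn n)).
have mE n A : m n A = ((w n)%:E * lambda (A `&` F n))%E by [].
have fin : fin_num_fun (mseries m 0).
  apply: lty_fin_num_fun; apply: (@le_lt_trans _ _ 1%E); last exact: ltry.
  have := @cvg_geometric_eseries_half R 1 0; rewrite expr0 divr1 => /cvg_lim <-//.
  apply: lee_nneseries => [n _ _|n _]; first exact: measure_ge0.
  rewrite mE setTI -[lambda _]fineK ?ge0_fin_numE//; last by case: (mF n).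
  rewrite lee_fin /w addn1 natrX div1r -mulrA ler_piMr ?invr_ge0 ?exprn_ge0//.
  by rewrite mulrC ler_pdivrMr ?ltr_wpDr// mul1r lerDr.
pose la : {finite_measure set T -> \bar R} :=
  HB.pack (mseries m 0) (Measure_isFinite.Build _ _ _ (mseries m 0) fin).
exists la; apply/null_content_dominatesP => A mA A0.
have AF n : lambda (A `&` F n) = 0%E.
  have : (m n A <= 0)%E.
    rewrite -A0 /= /mseries (nneseries_split 0 n.+1)// add0n big_nat_recr//=.
    rewrite -addeA (@le_trans _ _ (m n A + \sum_(n.+1 <= k <oo) m k A)%E)//.
      by rewrite leeDl// nneseries_ge0.
    by rewrite leeDr// sume_ge0.
  by rewrite mE pmule_rle0 ?lte_fin// measure_le0 => /eqP.
have -> : A = \bigcup_n (A `&` F n) by rewrite -setI_bigcupr -TF setIT.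
apply/eqP; rewrite -measure_le0.
have mAF n : measurable (A `&` F n) by exact: measurableI.
have := measure_sigma_subadditive lambda mAF (bigcupT_measurable _ mAF) (fun x => id).
by move/le_trans; apply; rewrite eseries0// => n _ _; exact: AF.
Qed.

End dominating_finite_measure.

Section borel_semigroup.
Variables (R : realType) (S : topMonoidType).
Variable lambda : {sigma_finite_measure set (borel S) -> \bar R}.
Hypothesis countable_basis : @second_countable S.
Hypothesis qi : quasi_invariant lambda.

Definition mul_mfun : {mfun (borel S * borel S)%type >-> borel S} :=
  HB.pack (@mulp S) (isMeasurableFun.Build _ _ _ _ (@mulp S)
    (measurable_mulp countable_basis)).

(** Quasi-invariance transports null sets backwards along translations. *)
Lemma translate_null (pi : {measure set (borel S) -> \bar R}) (A : set (borel S)) s :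
  pi `<< lambda -> measurable A -> lambda A = 0%E ->
  pi (lmul s @^-1` A) = 0%E.
Proof.
move=> /null_content_dominatesP dom mA A0; apply: dom.
  by rewrite -[X in measurable X]setTI; exact: measurable_lmul.
by have /null_content_dominatesP := qi s; exact.
Qed.

Lemma ae_translate (pi : {measure set (borel S) -> \bar R}) (P : borel S -> Prop) s :
  pi `<< lambda -> (\forall t \ae lambda, P t) -> \forall t \ae pi, P (lmul s t).
Proof.
move=> dom [A [mA A0 PA]]; exists (lmul s @^-1` A); split.
- by rewrite -[X in measurable X]setTI; exact: measurable_lmul.
- exact: translate_null.
- by move=> t /= nP; exact: PA.
Qed.

Lemma Rintegral_distribution (theta : probability (borel S) R) s M (f : borel S -> R) :
  bounded_by M f ->
  \int[distribution theta (lmul s)]_t f t = average mul_mfun theta f s.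
Proof.
move=> bf; congr fine; rewrite integral_distribution//.
  by apply/measurable_EFinP; case: bf.
exact: (bounded_by_integrable theta (bounded_by_translate mul_mfun s bf)).
Qed.

Lemma reiter_asymptotically_invariant (theta : nat -> probability (borel S) R) :
  (forall s, tv_norm (measure_diff (theta n) (distribution (theta n) (lmul s)))
    @[n --> \oo] --> 0%E) ->
  asymptotically_invariant mul_mfun theta.
Proof.
move=> cvg0 s.
exists (fun n => fine (tv_norm (measure_diff (theta n)
    (distribution (theta n) (lmul s))))).
  by have /fine_cvgP[] := cvg0 s.
move=> n f bf; rewrite -(Rintegral_distribution _ _ bf) distrC -[leRHS]mul1r.
exact: le_tv_norm_Rintegral.
Qed.

(** An essentially bounded function is replaced by its truncation [w], then by
    [average w].  The latter is harmonic at every point, and not just almost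
    everywhere: [pi] is dominated by [lambda] and [lambda] is quasi-invariant,
    so changing a function on a null set does not change its averages at any
    point. *)
Lemma harmonic_bounded_version (pi : probability (borel S) R) (u : borel S -> R) M :
  pi `<< lambda -> 0 < M -> measurable_fun setT u ->
  (\forall s \ae lambda, `|u s| <= M) ->
  (\forall s \ae lambda, \int[pi]_t u (lmul s t) = u s) ->
  exists v, [/\ bounded_by 1 v, forall s, average mul_mfun pi v s = v s &
    \forall s \ae lambda, u s = M * v s].
Proof.
move=> dom M0 mu uM Pu.
(* on the set where [|u| <= M] the truncation of [u / M] does nothing *)
pose w s := Num.max (-1) (Num.min 1 (M^-1 * u s)).
have bw : bounded_by 1 w.
  split.
    apply: measurable_maxr => //; apply: measurable_minr => //.
    exact: measurable_funM.
  by move=> s; rewrite ler_norml /w le_max lexx/= ge_max ge_min lexx/= andbT; lra.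
have uw : \forall s \ae lambda, u s = M * w s.
  apply: filterS uM => s; rewrite ler_norml => /andP[h1 h2].
  rewrite /w min_r; last by rewrite ler_pdivrMl ?mulr1.
  rewrite max_r; last by rewrite ler_pdivlMl ?mulrN1.
  by rewrite mulrA divff ?gt_eqF// mul1r.
have Mv s : \int[pi]_t u (lmul s t) = M * average mul_mfun pi w s.
  rewrite -(bounded_RintegralZl _ _ (bounded_by_translate mul_mfun s bw)).
  apply: eq_ae_Rintegral.
  - by apply: filterS (ae_translate s dom uw) => t h _.
  - by apply: measurableT_comp => //; exact: measurable_lmul.
  - by apply: measurable_funM => //; case: (bounded_by_translate mul_mfun s bw).
pose v := average mul_mfun pi w.
have vw : \forall s \ae lambda, v s = w s.
  move: Pu uw; apply: (@filterS2 _ (almost_everywhere lambda)) => s.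
  by rewrite Mv => h1 h2; apply: (mulfI (lt0r_neq0 M0)); rewrite h1.
have bv : bounded_by 1 v.
  have := bounded_by_average mul_mfun pi bw.
  by rewrite mass_probability mulr1.
exists v; split => //.
  move=> s; apply: eq_ae_Rintegral.
  - by apply: filterS (ae_translate s dom vw) => t h _; exact: h.
  - by case: (bounded_by_translate mul_mfun s bv).
  - by case: (bounded_by_translate mul_mfun s bw).
by move: uw vw; apply: (@filterS2 _ (almost_everywhere lambda)) => s -> ->.
Qed.

End borel_semigroup.

(** * Reiter implies Liouville *)

Section complex_bounds.
Variable R : realType.

Lemma normc_ge_parts (z : R[i]) :
  `|complex.Re z| <= Normc.normc z /\ `|complex.Im z| <= Normc.normc z.
Proof.
case: z => a b /=; rewrite -!sqrtr_sqr.
by rewrite !ler_wsqrtr ?lerDl ?lerDr ?sqr_ge0.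
Qed.

End complex_bounds.

Section reiter_implies_liouville.
Variables (R : realType) (S : topMonoidType).
Variable lambda : {sigma_finite_measure set (borel S) -> \bar R}.
Hypothesis countable_basis : @second_countable S.
Hypothesis qi : quasi_invariant lambda.

(** The norm in the definition of [Linfty] is an essential supremum only when
    [lambda] is nonzero; for [lambda = 0] any bound holds almost
    everywhere. *)
Lemma Linfty_bounded (f : borel S -> R[i]) : Linfty lambda f ->
  exists2 M : R, 0 < M &
    \forall s \ae lambda, `|complex.Re (f s)| <= M /\ `|complex.Im (f s)| <= M.
Proof.
move=> [_ _]; rewrite unlock /Lnorm.body; case: ifPn => [_|]; last first.
  rewrite -leNgt measure_le0 => /eqP l0 _; exists 1 => //.
  by exists setT; split.
move=> /(@ess_supr_bounded _ _ _ lambda (fun s => `|Normc.normc (f s)|)) [M HM].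
exists (Num.max M 1); first by rewrite lt_max ltr01 orbT.
apply: filterS HM => s hM; have [h1 h2] := normc_ge_parts (f s).
have h : Normc.normc (f s) <= Num.max M 1.
  by rewrite le_max (le_trans (ler_norm _) hM).
by split; [exact: le_trans h1 h|exact: le_trans h2 h].
Qed.

Lemma constants_harmonic (pi : probability (borel S) R) : pi `<< lambda ->
  Linfty_constants lambda `<=` harmonic lambda pi.
Proof.
move=> dom f [Lf [c fc]]; split => //.
have Pf s : markov_op pi f s = c.
  have fc' := ae_translate qi s dom fc; have [mRe mIm _] := Lf.
  have int (u : borel S -> R) (r : R) : measurable_fun setT u ->
      (\forall t \ae pi, u (lmul s t) = r) -> \int[pi]_t u (lmul s t) = r.
    move=> mu ur; transitivity (\int[pi]_t r).
      apply: eq_ae_Rintegral; first by apply: filterS ur => t h _.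
        by apply: measurableT_comp => //; exact: measurable_lmul.
      exact: measurable_cst.
    by rewrite Rintegral_cstT mass_probability mulr1.
  rewrite /markov_op /Cintegral.
  rewrite (int (fun s => complex.Re (f s)) (complex.Re c))//; last first.
    by apply: filterS fc' => t /(_ Logic.I) ->.
  rewrite (int (fun s => complex.Im (f s)) (complex.Im c))//; last first.
    by apply: filterS fc' => t /(_ Logic.I) ->.
  by case: (c).
by apply: filterS fc => s /(_ Logic.I) h _; rewrite Pf h.
Qed.

(** The real and the imaginary part of a harmonic function are harmonic, so
    the real statement [asymptotically_invariant_liouville] applies to
    each. *)
Lemma liouville_of_reiter : reiter lambda -> liouville lambda.
Proof.
move=> [theta [dom cvg0]].
have [la lambda_la] := dominating_finite_measure lambda.
have ai := reiter_asymptotically_invariant countable_basis cvg0.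
have theta1 n : mass (theta n) = 1 by exact: mass_probability.
have [pi [pidom piL]] := asymptotically_invariant_liouville la theta1 ai.
have {}pidom : pi `<< lambda by exact: pidom.
exists pi; split=> //; apply/seteqP; split; last exact: constants_harmonic.
move=> f [Lf Pf]; split=> //.
have [mRe mIm _] := Lf; have [M M0 fM] := Linfty_bounded Lf.
have part (u : borel S -> R) : measurable_fun setT u ->
    (\forall s \ae lambda, `|u s| <= M) ->
    (\forall s \ae lambda, \int[pi]_t u (lmul s t) = u s) ->
    exists c, \forall s \ae lambda, u s = c.
  move=> mu uM Pu.
  have [v [bv Pv uv]] := harmonic_bounded_version countable_basis qi pidom M0 mu uM Pu.
  have [c vc] := piL v bv Pv; exists (M * c).
  have {}vc := null_dominates_ae_eq measurableT lambda_la vc.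
  move: uv vc; apply: (@filterS2 _ (almost_everywhere lambda)) => s -> vc.
  by rewrite vc.
have [||a fa] := part (fun s => complex.Re (f s)) mRe.
- by apply: filterS fM => s [].
- by apply: filterS Pf => s /(_ Logic.I) <-.
have [||b fb] := part (fun s => complex.Im (f s)) mIm.
- by apply: filterS fM => s [].
- by apply: filterS Pf => s /(_ Logic.I) <-.
exists (Complex a b); move: fa fb.
apply: (@filterS2 _ (almost_everywhere lambda)) => s fa fb _.
by rewrite /= -fa -fb; case: (f s).
Qed.

End reiter_implies_liouville.

(** * Liouville implies Reiter *)

Lemma Rintegral_mrestr d (T : measurableType d) (R : realType)
    (mu : {finite_measure set T -> \bar R}) (A : set T) (mA : measurable A) M
    (f : T -> R) : bounded_by M f ->
  \int[mrestr mu mA]_x f x = \int[mu]_(x in A) f x.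
Proof.
move=> bf; congr fine; have mC : measurable (~` A) by exact: measurableC.
rewrite (negligible_integral mC)//; last by rewrite /= /mrestr setICl measure0.
  by rewrite setTD setCK; apply: eq_measure_integral => B mB BA;
    rewrite /= /mrestr setIidl.
exact: (bounded_by_integrable (mrestr mu mA) bf).
Qed.

Lemma probability_of_mass1 d (T : measurableType d) (R : realType)
    (mu : {finite_measure set T -> \bar R}) : mass mu = 1 ->
  exists P : probability T R, forall A, P A = mu A.
Proof.
move=> mu1; exists (mnormalize mu (dirac point)) => A; rewrite /= /mnormalize.
have muT : (mu : {measure set T -> \bar R}) setT = 1%E by rewrite -[LHS]massE mu1.
by rewrite muT onee_eq0/= invr1 mule1.
Qed.

Section cesaro.
Context d (T : measurableType d) (R : realType) (mul : {mfun (T * T)%type >-> T}).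
Local Notation fmeas := {finite_measure set T -> \bar R}.
Variable pi : fmeas.
Hypothesis pi1 : mass pi = 1.
Hypothesis mulA : forall x y z, mul (x, mul (y, z)) = mul (mul (x, y), z).
Local Notation P := (average mul pi).

Fixpoint conv_power (k : nat) : fmeas :=
  if k is k'.+1 then conv mul (conv_power k') pi else pi.

Fixpoint conv_power_sum (k : nat) : fmeas :=
  if k is k'.+1 then fadd (conv_power_sum k') (conv_power k) else pi.

Fixpoint iter_sum (f : T -> R) (k : nat) : T -> R :=
  if k is k'.+1 then fun s => iter_sum f k' s + iter k P f s else f.

Lemma bounded_by_iter k M f : bounded_by M f -> bounded_by M (iter k P f).
Proof.
move=> bf; elim: k => //= k IH.
by have := bounded_by_average mul pi IH; rewrite pi1 mulr1.
Qed.

Lemma bounded_by_iter_sum k M f : bounded_by M f ->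
  bounded_by (M * k.+1%:R) (iter_sum f k).
Proof.
move=> bf; elim: k => [|k IH]; first by rewrite mulr1.
rewrite -addn1 natrD mulrDr mulr1; apply: bounded_byD => //.
exact: (bounded_by_iter k.+1).
Qed.

Lemma averageD M N (f g : T -> R) : bounded_by M f -> bounded_by N g ->
  P (fun x => f x + g x) = (fun s => P f s + P g s).
Proof.
move=> bf bg; apply/funext => s.
exact: (bounded_RintegralD _ (bounded_by_translate mul s bf) (bounded_by_translate mul s bg)).
Qed.

(** Applying [P] shifts the sum by one term, so it telescopes. *)
Lemma average_iter_sum k M f : bounded_by M f ->
  P (iter_sum f k) = (fun s => iter_sum f k s + iter k.+1 P f s - f s).
Proof.
move=> bf; elim: k => [|k IH]; first by apply/funext => s; rewrite /= addrAC subrr add0r.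
rewrite (averageD (bounded_by_iter_sum k bf) (bounded_by_iter k.+1 bf)) IH.
by apply/funext => s; rewrite /=; ring.
Qed.

(** By associativity, translating a convolution on the left translates its
    first factor. *)
Lemma average_conv mu M f s : bounded_by M f ->
  average mul (conv mul mu pi) f s = average mul mu (P f) s.
Proof.
move=> bf; rewrite [LHS](Rintegral_conv mul _ _ (bounded_by_translate mul s bf)).
apply: eq_Rintegral => x _; apply: eq_Rintegral => y _.
by rewrite mulA.
Qed.

Lemma Rintegral_conv_power k M f : bounded_by M f ->
  \int[conv_power k]_x f x = \int[pi]_x iter k P f x.
Proof.
elim: k f => // k IH f bf; rewrite (Rintegral_conv mul _ _ bf) iterSr.
exact: (IH _ (bounded_by_iter 1 bf)).
Qed.

Lemma average_conv_power k M f s : bounded_by M f ->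
  average mul (conv_power k) f s = P (iter k P f) s.
Proof.
elim: k f => // k IH f bf; rewrite (average_conv _ _ bf) iterSr.
exact: (IH _ (bounded_by_iter 1 bf)).
Qed.

Lemma Rintegral_conv_power_sum k M f : bounded_by M f ->
  \int[conv_power_sum k]_x f x = \int[pi]_x iter_sum f k x.
Proof.
move=> bf; elim: k => // k IH.
rewrite (Rintegral_fadd _ _ bf) IH (Rintegral_conv_power k.+1 bf).
by rewrite -(bounded_RintegralD _ (bounded_by_iter_sum k bf) (bounded_by_iter k.+1 bf)).
Qed.

Lemma average_conv_power_sum k M f s : bounded_by M f ->
  average mul (conv_power_sum k) f s = P (iter_sum f k) s.
Proof.
move=> bf; elim: k => // k IH.
rewrite (averageD (bounded_by_iter_sum k bf) (bounded_by_iter k.+1 bf)) -IH.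
rewrite -(average_conv_power k.+1 s bf).
exact: (Rintegral_fadd _ _ (bounded_by_translate mul s bf)).
Qed.

Definition cesaro_weight k : {nonneg R} := (k.+1%:R^-1 : R)%:nng.

Definition cesaro k : fmeas := mscale (cesaro_weight k) (conv_power_sum k).

(** The function dual to [cesaro]: integrating it against [pi] is integrating
    [f] against the Cesaro mean of the convolution powers of [pi]. *)
Definition cesaro_fun f k : T -> R := fun s => k.+1%:R^-1 * iter_sum f k s.

Lemma bounded_by_cesaro_fun k f : bounded_by 1 f -> bounded_by 1 (cesaro_fun f k).
Proof.
move=> bf; have [mS S1] := bounded_by_iter_sum k bf.
split=> [|s]; first exact: measurable_funM.
by rewrite normrM ger0_norm ?invr_ge0// mulrC ler_pdivrMr// S1.
Qed.

Lemma Rintegral_cesaro k f : bounded_by 1 f ->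
  \int[cesaro k]_x f x = \int[pi]_x cesaro_fun f k x.
Proof.
move=> bf; rewrite (Rintegral_mscale _ _ bf) (Rintegral_conv_power_sum _ bf).
by rewrite -(bounded_RintegralZl _ _ (bounded_by_iter_sum k bf)).
Qed.

Lemma average_cesaro k f s : bounded_by 1 f ->
  average mul (cesaro k) f s = P (cesaro_fun f k) s.
Proof.
move=> bf; rewrite [LHS](Rintegral_mscale _ _ (bounded_by_translate mul s bf)).
rewrite -/(average mul _ _ _) (average_conv_power_sum _ _ bf).
by rewrite -(bounded_RintegralZl _ _
  (bounded_by_translate mul s (bounded_by_iter_sum k bf))).
Qed.

Lemma mass_conv_power k : mass (conv_power k) = 1.
Proof. by elim: k => //= k IH; rewrite mass_conv IH pi1 mulr1. Qed.

Lemma mass_cesaro k : mass (cesaro k) = 1.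
Proof.
rewrite mass_mscale /=; suff -> : mass (conv_power_sum k) = k.+1%:R by rewrite mulVf.
elim: k => //= k IH; rewrite mass_fadd IH mass_conv mass_conv_power pi1 mulr1.
by rewrite -[k.+2]addn1 natrD.
Qed.

Lemma cesaro_fun_almost_harmonic k f s : bounded_by 1 f ->
  `|P (cesaro_fun f k) s - cesaro_fun f k s| <= 2 * k.+1%:R^-1.
Proof.
move=> bf; rewrite [P _ s](bounded_RintegralZl _ _
  (bounded_by_translate mul s (bounded_by_iter_sum k bf))).
rewrite -/(average mul pi _ _) (average_iter_sum _ bf) /cesaro_fun.
rewrite (_ : _ - _ = k.+1%:R^-1 * (iter k.+1 P f s - f s)); last by ring.
rewrite normrM ger0_norm ?invr_ge0// mulrC ler_wpM2r ?invr_ge0//.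
have [_ h1] := bounded_by_iter k.+1 bf; have [_ h2] := bf.
by rewrite (le_trans (ler_normB _ _))// lerD.
Qed.

End cesaro.

Section liouville_implies_reiter.
Variables (R : realType) (S : topMonoidType).
Variable lambda : {sigma_finite_measure set (borel S) -> \bar R}.
Hypothesis countable_basis : @second_countable S.
Hypothesis qi : quasi_invariant lambda.
Local Notation mul := (mul_mfun countable_basis).

Lemma mul_mfunA (x y z : borel S) : mul (x, mul (y, z)) = mul (mul (x, y), z).
Proof. exact: mulgA. Qed.

(** The value at [A] is an integral of the numbers [pi (s^-1 A)], which vanish
    by quasi-invariance when [lambda A = 0].  Hence weak-star limits can be
    tested on [conv mul mu pi] for every finite [mu]. *)
Lemma conv_dominated (mu pi : {finite_measure set (borel S) -> \bar R}) :
  pi `<< lambda -> conv mul mu pi `<< lambda.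
Proof.
move=> dom; apply/null_content_dominatesP => A mA A0.
rewrite convE integral0_eq// => s _; exact: translate_null.
Qed.

(** For every Borel set [A], the integrals of [average g0] and of [g0] over
    [A] are the limits of the integrals of [g_n] against [la_A pi] and against
    [la_A], with [la_A] the restriction of [la] to [A].  The hypothesis of
    approximate harmonicity makes these limits equal. *)
Lemma harmonic_weak_limit (la pi : {finite_measure set (borel S) -> \bar R})
    (U : set_system nat) (g : nat -> borel S -> R) (g0 : borel S -> R) :
  ProperFilter U -> U --> \oo -> lambda `<< la -> pi `<< lambda ->
  mass pi = 1 ->
  (forall n, bounded_by 1 (g n)) -> bounded_by 1 g0 ->
  (forall n s, `|average mul pi (g n) s - g n s| <= 2 * n.+1%:R^-1) ->
  (forall mu : {finite_measure set (borel S) -> \bar R}, mu `<< la ->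
    \int[mu]_x g n x @[n --> U] --> \int[mu]_x g0 x) ->
  \forall s \ae lambda, average mul pi g0 s = g0 s.
Proof.
move=> PU Uoo lla pil pi1 bg bg0 almost lim.
have bP h : bounded_by 1 h -> bounded_by 1 (average mul pi h).
  by move=> bh; have := bounded_by_average mul pi bh; rewrite pi1 mulr1.
have rest (A : set (borel S)) : measurable A ->
    \int[la]_(x in A) average mul pi g0 x = \int[la]_(x in A) g0 x.
  move=> mA; rewrite -(Rintegral_mrestr la mA (bP _ bg0)) -(Rintegral_mrestr la mA bg0).
  pose m : {finite_measure set (borel S) -> \bar R} := mrestr la mA.
  rewrite -/m -(Rintegral_conv mul m pi bg0).
  have mla : m `<< la.
    apply/null_content_dominatesP => B mB B0; rewrite /= /mrestr.
    by apply/eqP; rewrite -measure_le0 -B0 le_measure ?inE//; exact: measurableI.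
  have cla : conv mul m pi `<< la.
    exact: null_dominates_trans (conv_dominated m pil) lla.
  have c1 := lim _ cla; have c2 := lim _ mla.
  have FU : Filter U by typeclasses eauto.
  have c3 := cvgB c1 c2; have {}c3 := c3 FU.
  apply/eqP; rewrite -subr_eq0; apply/eqP.
  rewrite -(cvg_lim _ c3)//; apply/cvg_lim => //; apply/norm_cvg0P.
  have inv0 : 2 * mass m * n.+1%:R^-1 @[n --> U] --> (0 : R).
    apply: cvg_trans (cvg_app _ Uoo) _; rewrite -(mulr0 (2 * mass m)).
    by apply: cvgM; [exact: cvg_cst|exact: cvg_harmonic].
  apply: (@squeeze_cvgr _ _ _ _ (cst 0) (fun n => 2 * mass m * n.+1%:R^-1)) => //;
    last exact: cvg_cst.
  apply: nearW => n; rewrite normr_ge0/= !fctE (Rintegral_conv mul m pi (bg n)).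
  rewrite -(bounded_RintegralB _ (bP _ (bg n)) (bg n)) mulrAC.
  apply: norm_Rintegral_le; split; last exact: almost.
  by case: (bounded_byB (bP _ (bg n)) (bg n)).
have E : (EFin \o average mul pi g0) = (EFin \o g0) %[ae la].
  apply: integral_ae_eq => //; first exact: bounded_by_integrable (bP _ bg0).
    by apply/measurable_EFinP; case: bg0.
  move=> A _ mA; have := rest A mA; rewrite /Rintegral => h.
  rewrite -[LHS]fineK ?h ?fineK//; apply: integrable_fin_num => //;
    apply: (integrableS measurableT) => //.
    exact: bounded_by_integrable bg0.
  exact: bounded_by_integrable (bP _ bg0).
have := null_dominates_ae_eq measurableT lla E.
by apply: filterS => s /(_ Logic.I) /= [].
Qed.

(** A real harmonic function is a complex one with zero imaginary part. *)
Lemma liouville_real (pi : probability (borel S) R) (g : borel S -> R) :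
  harmonic lambda pi = Linfty_constants lambda -> bounded_by 1 g ->
  (\forall s \ae lambda, average mul pi g s = g s) ->
  exists c, \forall s \ae lambda, g s = c.
Proof.
move=> HL [mg g1] Pg.
have : harmonic lambda pi (fun s => Complex (g s) 0).
  split.
    split => //=; rewrite unlock /Lnorm.body; case: ifPn => // _.
    apply: (@le_lt_trans _ _ 1%E); last exact: ltry.
    apply/ess_supP; apply: aeW => s /=.
    by rewrite expr0n/= addr0 sqrtr_sqr lee_fin normr_id.
  apply: filterS Pg => s h _.
  rewrite /markov_op /Cintegral /= -/(average mul pi g s) h.
  by congr Complex; rewrite Rintegral_cst// mul0r.
rewrite HL => -[_ [c gc]]; exists (complex.Re c).
by apply: filterS gc => s /(_ Logic.I) /(congr1 (@complex.Re R)).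
Qed.

(** If the total variations do not tend to zero, the bad indices meet every
    neighbourhood of infinity and so generate a proper filter with them.
    Along an ultrafilter refining it the averaged indicators of the bad sets
    have a harmonic weak-star limit, which by hypothesis is a constant and so
    has the same integral against [pi] and [s pi]. *)
Lemma reiter_of_liouville : liouville lambda -> reiter lambda.
Proof.
move=> [pi [pil HL]].
have pi1 : mass pi = 1 by exact: mass_probability.
have [la lla] := dominating_finite_measure lambda.
have /choice[theta thetaE] : forall n, exists P : probability (borel S) R,
    forall A, P A = cesaro mul pi n A.
  by move=> n; apply: probability_of_mass1; exact: mass_cesaro.
have cpl k : conv_power mul pi k `<< lambda.
  by case: k => //= k; exact: conv_dominated.
exists theta; split.
  move=> n; apply/null_content_dominatesP => A mA A0; rewrite thetaE.
  rewrite /cesaro /= /mscale [X in (_ * X)%E](_ : _ = 0%E) ?mule0//.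
  have zero k : conv_power mul pi k A = 0%E.
    by have /null_content_dominatesP := cpl k; exact.
  by elim: n => [|n IH]; [exact: (zero 0%N)|rewrite /= faddE IH add0e; exact: (zero n.+1)].
move=> s.
pose f A : borel S -> R := \1_A.
pose g A n := cesaro_fun mul pi (f A) n.
have bf A : measurable A -> bounded_by 1 (f A) by move=> mA; exact: bounded_by_indic.
have bg A n : measurable A -> bounded_by 1 (g A n).
  by move=> mA; exact: bounded_by_cesaro_fun (bf _ mA).
have th1 A n : measurable A -> fine (theta n A) = \int[pi]_x g A n x.
  move=> mA; rewrite thetaE -Rintegral_indicT//.
  exact: Rintegral_cesaro (bf A mA).
have th2 A n : measurable A ->
    fine (distribution (theta n) (lmul s) A) = average mul pi (g A n) s.
  move=> mA; rewrite /distribution /pushforward /= thetaE.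
  rewrite -(average_cesaro pi1 mul_mfunA _ _ (bf A mA)).
  rewrite -Rintegral_indicT//.
  by rewrite -[X in measurable X]setTI; exact: measurable_lmul.
pose gap A n : R := `|fine (theta n A) - fine (distribution (theta n) (lmul s) A)|.
have small e : 0 < e -> \forall n \near \oo, forall A, measurable A -> gap A n <= e.
  move=> e0; pose Bad := [set n | exists A, measurable A /\ e < gap A n].
  suff : \forall n \near \oo, ~ Bad n.
    apply: filterS => n nB A mA; rewrite leNgt; apply/negP => eA.
    by apply: nB; exists A.
  apply: contrapT => nB.
  (* if [Bad] were eventually false there would be nothing to prove, so the
     trace of the filter on it is proper *)
  have PB : ProperFilter (within Bad \oo) by constructor; [exact: nB|typeclasses eauto].
  have [U [UU BU]] := ultraFilterLemma PB.
  have PU : ProperFilter U by exact: ultra_proper.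
  have Uoo : U --> \oo by move=> V Voo; apply: BU; rewrite /within; apply: filterS Voo.
  have UBad : U Bad by apply: BU; exact: withinT.
  have /choice[A_ A_P] : forall n, exists A, measurable A /\ (Bad n -> e < gap A n).
    move=> n; have [[A [mA eA]]|nb] := pselect (Bad n); first by exists A.
    by exists set0; split => // /nb.
  have mA_ n : measurable (A_ n) by case: (A_P n).
  pose h n := g (A_ n) n.
  have bh n : bounded_by 1 (h n) by exact: bg.
  have [g0 bg0 lim] := weak_limit la UU bh.
  have harm : \forall t \ae lambda, average mul pi g0 t = g0 t.
    apply: (harmonic_weak_limit PU Uoo lla pil pi1 bh bg0 _ lim) => n t.
    exact: cesaro_fun_almost_harmonic (bf _ (mA_ n)).
  have [c gc] := liouville_real HL bg0 harm.
  (* [g0] is almost everywhere constant for [lambda], hence for [pi] and for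
     [s pi] *)
  pose spi : {finite_measure set (borel S) -> \bar R} := distribution pi (lmul s).
  have spil : spi `<< lambda.
    by apply/null_content_dominatesP => A mA A0; exact: translate_null pil mA A0.
  have const (m : {finite_measure set (borel S) -> \bar R}) : m `<< lambda ->
      mass m = 1 -> \int[m]_x g0 x = c.
    move=> ml m1; transitivity (\int[m]_x c).
      apply: eq_ae_Rintegral; [|by case: bg0|exact: measurable_cst].
      have gc' : ae_eq lambda setT g0 (cst c) by apply: filterS gc => t ht _.
      exact: null_dominates_ae_eq measurableT ml gc'.
    by rewrite Rintegral_cstT m1 mulr1.
  have l1 := lim _ (null_dominates_trans pil lla : pi `<< la).
  have l2 := lim spi (null_dominates_trans spil lla).
  rewrite (const _ pil pi1) in l1.
  rewrite (const _ spil (mass_probability _)) in l2.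
  have e2 : 0 < e / 2 by rewrite divr_gt0.
  have /cvgrPdist_lt /(_ _ e2) n1 := l1; have /cvgrPdist_lt /(_ _ e2) n2 := l2.
  have [n [[Bn h1] h2]] := filter_ex (filterI (filterI UBad n1) n2).
  have := (A_P n).2 Bn; apply/negP; rewrite -leNgt /gap th1// th2// -/(h n).
  move: h1 h2; rewrite (Rintegral_distribution countable_basis pi s (bh n)).
  rewrite !ltr_norml ler_norml => /andP[? ?] /andP[? ?].
  by apply/andP; split; lra.
apply/fine_cvgP; split; first by apply: nearW => n; exact: tv_norm_fin_num.
apply/cvgrPdist_le => e e0; have e2 : 0 < e / 2 by rewrite divr_gt0.
apply: filterS (small _ e2) => n hn; rewrite sub0r normrN /=.
have le := tv_norm_le hn; rewrite -splitr in le.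
have tfin := tv_norm_fin_num (theta n) (distribution (theta n) (lmul s)).
have ge : (0 <= tv_norm (measure_diff (theta n) (distribution (theta n) (lmul s))))%E.
  by rewrite /tv_norm; exact: measure_ge0.
by rewrite ger0_norm ?fine_ge0// -lee_fin fineK.
Qed.

End liouville_implies_reiter.

Theorem theorem6p9 (R : realType) (S : topMonoidType)
    (lambda : {sigma_finite_measure set (borel S) -> \bar R}) :
  @second_countable S ->
  locally_compact [set: S] ->
  hausdorff_space S ->
  quasi_invariant lambda ->
  borel_translate_density lambda ->
  liouville lambda <-> reiter lambda.
Proof.
move=> countable_basis _ _ qi _.
by split; [exact: reiter_of_liouville|exact: liouville_of_reiter].
Qed.
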